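(* Let $\mu$ be a probability measure on $\mathbb{R}^d$ that is absolutely continuous with respect to Lebesgue measure, let $t>0$, and let $\eta$ be a Poisson point process on $\mathbb{R}^d$ with intensity measure $t\mu$. Let $\Pi_t$ be the convex hull of the points of $\eta$, and let $I(\Pi_t)$ be the number of points of $\eta$ lying in the interior of $\Pi_t$. Then the generating function $g_{I(\Pi_t)}(z)=\mathbb{E}\, z^{I(\Pi_t)}$ and the moment generating function $h_{\mu(\Pi_t)}(z)=\mathbb{E}\, e^{z\mu(\Pi_t)}$ are entire functions on $\mathbb{C}$ and satisfy, for all $z\in\mathbb{C}$, $$g_{I(\Pi_t)}(z+1)=h_{\mu(\Pi_t)}(tz).$$
   Context: A Poisson point process $\eta$ with intensity measure $t\mu$ is a random finite simple counting measure such that $\eta(A)$ is Poisson distributed with parameter $t\mu(A)$ for every Borel set $A$ and $\eta(A_1),\dots,\eta(A_m)$ are independent for pairwise disjoint Borel sets. $\mu(\Pi_t)$ denotes the $\mu$-measure of the random polytope $\Pi_t$. *)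

(* Defs.v *)
From HB Require Import structures.
From mathcomp Require Import all_boot all_order all_algebra.
From mathcomp Require Import all_classical all_reals all_analysis.
From mathcomp Require Import complex.
Set Implicit Arguments.
Unset Strict Implicit.
Unset Printing Implicit Defensive.
Import Order.TTheory GRing.Theory Num.Theory.
Import numFieldTopology.Exports.
Local Open Scope classical_set_scope.
Local Open Scope ring_scope.

Definition borel_rV (R : realType) (d : nat) :=
  g_sigma_algebraType (@open 'rV[R]_d).

Definition box (R : realType) (d : nat) (a b : 'rV[R]_d) : set 'rV[R]_d :=
  [set x | forall i : 'I_d, a ord0 i <= x ord0 i <= b ord0 i].

Definition box_vol (R : realType) (d : nat) (a b : 'rV[R]_d) : R :=
  \prod_(i < d) (b ord0 i - a ord0 i).

Definition lebesgue_null (R : realType) (d : nat) (A : set 'rV[R]_d) : Prop :=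
  forall e : R, 0 < e -> exists a b : nat -> 'rV[R]_d,
    (forall k (i : 'I_d), a k ord0 i <= b k ord0 i) /\
    A `<=` \bigcup_k box (a k) (b k) /\
    (forall N, \sum_(k < N) box_vol (a k) (b k) <= e).

Definition abs_cont_lebesgue (R : realType) (d : nat)
    (mu : set (borel_rV R d) -> \bar R) : Prop :=
  forall A : set (borel_rV R d), measurable A -> lebesgue_null A -> mu A = 0%E.

(* Poisson distribution with parameter lam >= 0 (lam = 0 gives Dirac at 0) *)
Definition poisson_p (R : realType) (lam : R) (n : nat) : R :=
  expR (- lam) * lam ^+ n / (n`!)%:R.

Definition npoints (T : Type) (s : seq T) (A : set T) : nat :=
  count (fun x => `[< A x >]) s.

(* eta : Omega -> seq (R^d) is a Poisson point process with intensity
   measure nu: a random finite simple counting measure (a duplicate-free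
   finite list of points) such that eta(A) is measurable and Poisson(nu A)
   distributed for each Borel A, and eta(A_1), ..., eta(A_m) are independent
   for pairwise disjoint Borel A_1, ..., A_m. *)
Definition is_poisson_pp (R : realType) (d : nat)
    (dO : measure_display) (Omega : measurableType dO)
    (P : probability Omega R) (eta : Omega -> seq 'rV[R]_d)
    (nu : set 'rV[R]_d -> R) : Prop :=
  [/\ (forall w, uniq (eta w)),
      (forall (A : set (borel_rV R d)), measurable A -> forall n : nat,
          measurable [set w | npoints (eta w) A = n] /\
          P [set w | npoints (eta w) A = n] = (poisson_p (nu A) n)%:E) &
      (forall (m : nat) (A : 'I_m -> set (borel_rV R d)) (n : 'I_m -> nat),
          (forall i, measurable (A i)) ->
          (forall i j, i != j -> A i `&` A j = set0) ->
          P (\bigcap_(i in [set: 'I_m]) [set w | npoints (eta w) (A i) = n i])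
          = (\prod_(i < m) P [set w | npoints (eta w) (A i) = n i])%E)].

Definition conv_hull (R : realType) (d : nat) (s : seq 'rV[R]_d)
    : set 'rV[R]_d :=
  [set x | exists lam : 'I_(size s) -> R,
     [/\ forall i, 0 <= lam i, \sum_i lam i = 1 &
         x = \sum_i lam i *: nth 0 s i]].

Definition n_interior (R : realType) (d : nat) (s : seq 'rV[R]_d) : nat :=
  npoints s (interior (conv_hull s)).

Definition cRe (R : realType) (z : R[i]) : R := complex.Re z.
Definition cIm (R : realType) (z : R[i]) : R := complex.Im z.

Definition cabs (R : realType) (z : R[i]) : R :=
  Num.sqrt (cRe z ^+ 2 + cIm z ^+ 2).

Definition cexp (R : realType) (w : R[i]) : R[i] :=
  Complex (expR (cRe w) * cos (cIm w)) (expR (cRe w) * sin (cIm w)).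

Definition cintegrable (R : realType) (dO : measure_display)
    (Omega : measurableType dO) (P : probability Omega R)
    (X : Omega -> R[i]) : Prop :=
  P.-integrable [set: Omega] (fun w => (cRe (X w))%:E) /\
  P.-integrable [set: Omega] (fun w => (cIm (X w))%:E).

Definition cexpect (R : realType) (dO : measure_display)
    (Omega : measurableType dO) (P : probability Omega R)
    (X : Omega -> R[i]) : R[i] :=
  Complex (Rintegral P [set: Omega] (fun w => cRe (X w)))
          (Rintegral P [set: Omega] (fun w => cIm (X w))).

Definition entire (R : realType) (f : R[i] -> R[i]) : Prop :=
  forall z0 : R[i], exists l : R[i], forall e : R, 0 < e ->
    exists2 delta : R, 0 < delta & forall z : R[i],
      0 < cabs (z - z0) < delta ->
      cabs ((f z - f z0) / (z - z0) - l) < e.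

(* Main.v *)
Require Import Defs.
From HB Require Import structures.
From mathcomp Require Import all_boot all_order all_algebra.
From mathcomp Require Import all_classical all_reals all_analysis.
From mathcomp Require Import measurable_realfun.
From mathcomp Require Import complex ring lra.
Import Order.TTheory GRing.Theory Num.Theory.
Import numFieldTopology.Exports.
Local Open Scope classical_set_scope.
Local Open Scope ring_scope.

Set Implicit Arguments.
Unset Strict Implicit.
Unset Printing Implicit Defensive.

(** Cut space into finitely many small disjoint cells, and call a cell deep when
    a slightly larger cube around its center lies in the convex hull of the
    centers of the occupied cells.  Emptying the deep cells does not change that
    hull, hence does not change which cells are deep.  So, given the set [V] of
    the cells that are occupied but not deep, the set of deep cells is
    determined by [V] and the counts in the deep cells are still independent
    Poisson variables; replacing [(1 + z) ^ N] by its mean [exp (z * lambda)] in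
    each deep cell gives [E (1 + z) ^ I = E exp (t z mu)] for the union of the
    deep cells.  When the cells shrink, this union converges pointwise to the
    interior of the random polytope, whose boundary is Lebesgue-null because it
    is porous, and dominated convergence (by [c ^ N], with [N] the total number
    of points) gives the theorem. *)

(** * Convex hulls of finite sets *)

(** The process is known only through its counts in fixed Borel sets, while the interior of the
    polytope is a random region built from the same points. Conditioning on the vertices is
    therefore replaced by finite families of independent counts. Depth is measured with cell
    centers, so that it depends on which cells are occupied and not on where the points sit inside
    them. One cancellation argument, [conv_hull_cancel], carries the geometry: it compares the hulls
    of nearby points and also yields the porosity of the boundary. Measurability of the functionals
    of the polytope is a by-product of the pointwise convergence. Only the generating function is
    differentiated; the identity then shows that the other function is entire, since [t] is
    nonzero. *)

Section ConvexHull.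
Variables (R : realType) (d : nat).
Implicit Types (s : seq 'rV[R]_d) (x y c p : 'rV[R]_d) (r e : R).

(** The closed ball of the sup norm, kept coordinatewise so that it serves both as a neighbourhood
    and as a [box]. Negative radii are allowed; the cube is then empty as soon as there is a
    coordinate. *)
Definition cube c r : set 'rV[R]_d :=
  [set y | forall i, `|y ord0 i - c ord0 i| <= r].

Lemma cube_center c r : 0 <= r -> cube c r c.
Proof. by move=> r0 i; rewrite subrr normr0. Qed.

Lemma cube_sym c r y : cube c r y -> cube y r c.
Proof. by move=> h i; rewrite distrC. Qed.

Lemma cube_trans c r y r' z : cube c r y -> cube y r' z -> cube c (r + r') z.
Proof.
move=> h1 h2 i; rewrite (_ : _ - _ = (z ord0 i - y ord0 i) + (y ord0 i - c ord0 i)).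
  by rewrite (le_trans (ler_normD _ _))// addrC lerD.
by rewrite addrA subrK.
Qed.

Lemma cube_le c r r' : r <= r' -> cube c r `<=` cube c r'.
Proof. by move=> rr y h i; exact: le_trans (h i) rr. Qed.

Lemma interiorP (A : set 'rV[R]_d) x :
  interior A x <-> exists2 r, 0 < r & cube x r `<=` A.
Proof.
split.
  move=> /nbhs_ballP[e/= e0 h]; exists (e / 2); first by rewrite divr_gt0.
  move=> y yx; apply: h; split=> // i j; rewrite ord1 /ball/= distrC.
  by apply: (le_lt_trans (yx j)); rewrite ltr_pdivrMr// ltr_pMr// ltr1n.
move=> [r r0 h]; apply/nbhs_ballP; exists r => //= y hy; apply: h => i.
by have := hy.2 ord0 i; rewrite /ball/= distrC => /ltW.
Qed.

Lemma conv_hull_mem s x : x \in s -> conv_hull s x.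
Proof.
move=> xs; have xi : (index x s < size s)%N by rewrite index_mem.
exists (fun i => if i == Ordinal xi then 1 else 0); split.
- by move=> i; case: ifP.
- by rewrite (bigD1 (Ordinal xi))//= eqxx big1 ?addr0// => i /negbTE ->.
- rewrite (bigD1 (Ordinal xi))//= eqxx big1 ?addr0 => [|i /negbTE ->].
    by rewrite scale1r nth_index.
  by rewrite scale0r.
Qed.

(** Flattening nested combinations. Points of zero weight are left unconstrained, so that unwanted
    points can be discarded by setting their weight to zero, as [conv_hull_split] does. *)
Lemma conv_hull_fin (I : finType) (a : I -> R) (q : I -> 'rV[R]_d) s :
  (forall i, 0 <= a i) -> \sum_i a i = 1 ->
  (forall i, a i != 0 -> conv_hull s (q i)) -> conv_hull s (\sum_i a i *: q i).
Proof.
move=> a0 a1 h.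
have [i0 ai0] : exists i, a i != 0.
  apply/not_existsP => H; have := a1; rewrite big1 => [/eqP|i _].
    by rewrite eq_sym oner_eq0.
  by apply/eqP/negPn/negP => /H.
(* Points of zero weight are replaced by a point known to lie in the hull, so that coefficients can
   be chosen for every index. *)
pose q' i := if a i != 0 then q i else q i0.
have h' i : conv_hull s (q' i).
  by rewrite /q'; case: ifP => [H|_]; apply: h.
have -> : \sum_i a i *: q i = \sum_i a i *: q' i.
  by apply: eq_bigr => i _; rewrite /q'; case: eqP => //= ->; rewrite !scale0r.
have /choice[b hb] : forall i, exists b : 'I_(size s) -> R,
    [/\ forall k, 0 <= b k, \sum_k b k = 1 & q' i = \sum_k b k *: nth 0 s k].
  exact: h'.
exists (fun k => \sum_i a i * b i k); split.
- by move=> k; apply: sumr_ge0 => i _; rewrite mulr_ge0//; case: (hb i).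
- rewrite exchange_big/= -[RHS]a1; apply: eq_bigr => i _.
  by rewrite -big_distrr/=; case: (hb i) => _ -> _; rewrite mulr1.
- under eq_bigr => i _.
    case: (hb i) => _ _ ->; rewrite scaler_sumr.
    under eq_bigr do rewrite scalerA.
    over.
  by rewrite exchange_big/=; apply: eq_bigr => k _; rewrite scaler_suml.
Qed.

Lemma conv_hull_sub s s' :
  (forall x, x \in s -> conv_hull s' x) -> conv_hull s `<=` conv_hull s'.
Proof.
move=> h x [a [a0 a1 ->]]; apply: conv_hull_fin => // i _.
by apply: h; rewrite mem_nth.
Qed.

Lemma conv_hull_conv s x y (a : R) : 0 <= a <= 1 ->
  conv_hull s x -> conv_hull s y -> conv_hull s (a *: x + (1 - a) *: y).
Proof.
move=> /andP[a0 a1] hx hy.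
have -> : a *: x + (1 - a) *: y =
   \sum_(i : bool) (if i then a else 1 - a) *: (if i then x else y).
  by rewrite big_bool/=.
apply: conv_hull_fin.
- by case=> //; rewrite subr_ge0.
- by rewrite big_bool/= addrC subrK.
- by case.
Qed.

(** The hull is the continuous image of the standard simplex of weights, which is closed and
    bounded. *)
Lemma conv_hull_compact s : compact (conv_hull s).
Proof.
set n := size s.
pose S := [set v : 'rV[R]_n | (forall i, 0 <= v ord0 i <= 1) /\
                              \sum_i v ord0 i = 1].
pose f (v : 'rV[R]_n) : 'rV[R]_d := \sum_i v ord0 i *: nth 0 s i.
have -> : conv_hull s = f @` S.
  apply/seteqP; split => x.
    move=> [a [a0 a1 ->]]; exists (\row_i a i).
      split; last by under eq_bigr do rewrite mxE.
      move=> i; rewrite mxE a0/= -a1 (bigD1 i)//= lerDl.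
      by apply: sumr_ge0.
    by rewrite /f; under eq_bigr do rewrite mxE.
  move=> [v [v0 v1] <-]; exists (v ord0); split=> // i.
  by case/andP: (v0 i).
apply: continuous_compact.
  apply: continuous_subspaceT; rewrite /f.
  apply: continuous_big => [|i _]; first exact: add_continuous.
  move=> v; apply: (@cvgZr_tmp R _ _ (nbhs v) _ (fun v : 'rV[R]_n => v ord0 i)).
  exact: (@coord_continuous R 1 n ord0 i v).
apply: bounded_closed_compact.
  exists 1; split; first exact: num_real.
  move=> M M1 v [v0 _]; rewrite /= [leLHS]/Num.norm /= mx_normrE.
  apply/bigmax_leP; split=> [|[i j] _]; first by rewrite (le_trans _ (ltW M1)).
  rewrite /= ord1; case/andP: (v0 j) => w0 w1.
  by rewrite ger0_norm// (le_trans w1)// ltW.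
pose g (v : 'rV[R]_n) : R := \sum_i v ord0 i.
have -> : S = \bigcap_i ((fun v : 'rV[R]_n => v ord0 i) @^-1` `[0, 1]%classic)
     `&` (g @^-1` [set 1]).
  apply/seteqP; split => v.
    by move=> [h1 h2]; split=> // i _ /=; rewrite in_itv/=.
  by move=> [h1 h2]; split=> // i; have := h1 i Logic.I; rewrite /= in_itv/=.
apply: closedI.
  apply: closed_bigI => i _; apply: (proj1 (continuous_closedP _)).
    by move=> ?; exact: coord_continuous.
  exact: itv_closed.
apply: (proj1 (continuous_closedP _)); last exact: closed_eq.
apply: continuous_big => [|i _]; first exact: add_continuous.
by move=> ?; exact: coord_continuous.
Qed.

End ConvexHull.

(** * Perturbation of hulls and removal of points *)

Section ConvexGeometry.
Variables (R : realType) (d : nat).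
Implicit Types (s : seq 'rV[R]_d) (x y c p : 'rV[R]_d) (r e : R).

Lemma conv_hull_closed s x :
  (forall e, 0 < e -> exists2 y, conv_hull s y & cube x e y) -> conv_hull s x.
Proof.
move=> h; have /closure_id -> : closed (conv_hull s).
  apply: compact_closed; last exact: conv_hull_compact.
  exact: norm_hausdorff.
move=> B /nbhs_interior/interiorP[r r0 rB].
have [y Ky xy] := h _ r0; exists y; split=> //.
exact: interior_subset (rB _ xy).
Qed.

Lemma cube_conv (I : finType) (a : I -> R) (q : I -> 'rV[R]_d) c r :
  (forall i, 0 <= a i) -> \sum_i a i = 1 -> (forall i, cube c r (q i)) ->
  cube c r (\sum_i a i *: q i).
Proof.
move=> a0 a1 h j; rewrite summxE.
have -> : c ord0 j = \sum_i a i * c ord0 j by rewrite -big_distrl/= a1 mul1r.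
rewrite -sumrB (le_trans (ler_norm_sum _ _ _))//.
have -> : r = \sum_i a i * r by rewrite -big_distrl/= a1 mul1r.
apply: ler_sum => i _; rewrite mxE -mulrBr normrM ger0_norm//.
by rewrite ler_wpM2l// h.
Qed.

Lemma conv_hull_cube s c r :
  (forall x, x \in s -> cube c r x) -> conv_hull s `<=` cube c r.
Proof.
move=> h x [a [a0 a1 ->]]; apply: cube_conv => // i.
by apply: h; rewrite mem_nth.
Qed.

Lemma seq_bounded s : exists2 r, 0 < r & forall x, x \in s -> cube 0 r x.
Proof.
elim: s => [|y s [r r0 h]]; first by exists 1.
exists (r + \sum_j `|y ord0 j|).
  by rewrite ltr_pwDl// sumr_ge0.
move=> x; rewrite inE => /orP[/eqP ->|/h]; last first.
  by apply: cube_le; rewrite lerDl sumr_ge0.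
move=> i; rewrite mxE subr0 (bigD1 i)//= addrCA lerDl.
by rewrite addr_ge0 ?sumr_ge0// ltW.
Qed.

(** Keep the weights and replace each point by its approximant. Combined with [conv_hull_cancel],
    this transfers a cube from one hull to the other at the cost of [e] in the radius. *)
Lemma conv_hull_approx s s' e :
  (forall x, x \in s -> exists2 c, conv_hull s' c & cube c e x) ->
  forall x, conv_hull s x -> exists2 c, conv_hull s' c & cube c e x.
Proof.
move=> h x [a [a0 a1 ->]].
have /choice[f hf] : forall i : 'I_(size s), exists c,
    conv_hull s' c /\ cube c e (nth 0 s i).
  by move=> i; have [c ? ?] := h _ (mem_nth 0 (ltn_ord i)); exists c.
exists (\sum_i a i *: f i); first by apply: conv_hull_fin => // i _; case: (hf i).
move=> j; rewrite !summxE -sumrB (le_trans (ler_norm_sum _ _ _))//.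
have -> : e = \sum_i a i * e by rewrite -big_distrl/= a1 mul1r.
apply: ler_sum => i _; rewrite !mxE -mulrBr normrM ger0_norm//.
by rewrite ler_wpM2l//; case: (hf i) => _; exact.
Qed.

(* Cancellation of [cube 0 e] in [cube c r `<=` K + cube 0 e]: starting from
   [b 0 = 0], write [y + b n = k n + b n.+1] with [k n] in [K]; averaging,
   [y] is the mean of the [k i] up to an error of size [e / n]. *)
Lemma conv_hull_cancel s c r e : 0 <= e ->
  (forall y, cube c r y -> exists2 k, conv_hull s k & cube k e y) ->
  cube c (r - e) `<=` conv_hull s.
Proof.
move=> e0 h y ycr.
have /choice[f hf] : forall b : 'rV[R]_d, exists k,
    cube 0 e b -> conv_hull s k /\ cube k e (y + b).
  move=> b; have [b0|nb] := pselect (cube 0 e b); last by exists 0.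
  have [k ? ?] : exists2 k, conv_hull s k & cube k e (y + b).
    apply: h => i; rewrite mxE addrAC -[r](subrK e).
    rewrite (le_trans (ler_normD _ _))// lerD//.
    by have := b0 i; rewrite mxE subr0.
  by exists k.
pose b n := iter n (fun b => y + b - f b) 0.
have hb n : cube 0 e (b n).
  elim: n => [|n ih]; first by move=> i /=; rewrite subrr normr0.
  by move=> i; have [_ /(_ i)] := hf _ ih; rewrite /= !mxE subr0.
have sum_b n : y *+ n = \sum_(i < n) f (b i) + b n.
  elim: n => [|n ih]; first by rewrite big_ord0 add0r.
  rewrite big_ord_recr/= mulrS ih.
  rewrite addrCA -!addrA; congr (_ + _).
  by rewrite [RHS]addrCA (addrC (f _)) subrK.
apply: conv_hull_closed => eps eps0.
pose n := `|Num.ceil (e / eps)|%N.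
exists (\sum_(i < n.+1) (n.+1%:R^-1) *: f (b i)).
  apply: conv_hull_fin => [i||i _]; first by rewrite invr_ge0.
    by rewrite sumr_const card_ord -[LHS]mulr_natl mulfV// pnatr_eq0.
  by have [] := hf _ (hb i).
move=> j; rewrite -scaler_sumr.
have -> : \sum_(i < n.+1) f (b i) = n.+1%:R *: y - b n.+1.
  by rewrite scaler_nat sum_b addrK.
have := hb n.+1; move: (b n.+1) => bn hbn.
rewrite scalerBr scalerA mulVf ?pnatr_eq0// scale1r !mxE addrAC subrr add0r normrN.
rewrite normrM ger0_norm ?invr_ge0//.
have := hbn j; rewrite mxE subr0 => hj.
rewrite ler_pdivrMl ?ltr0n// (le_trans hj)// -ler_pdivrMr//.
apply: (le_trans (ceil_ge _)); rewrite -natr1.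
have c0 : (0 <= Num.ceil (e / eps))%R by rewrite ceil_ge0 (@lt_le_trans _ _ 0) ?divr_ge0// ltW.
by rewrite -[leLHS](ger0_norm) ?ler0z// -intr_norm -natr_absz lerDl.
Qed.

(** Here [a] is the total weight carried by the copies of [p]. It is less than 1 because [x] differs
    from [p], so the remaining weights can be normalized. *)
Lemma conv_hull_split s s' p x :
  (forall y, y \in s -> y != p -> conv_hull s' y) -> conv_hull s x -> x != p ->
  exists a u, [/\ 0 <= a, a < 1, conv_hull s' u & x = a *: p + (1 - a) *: u].
Proof.
move=> h [a [a0 a1 xE]] xp.
pose w := \sum_(i : 'I_(size s) | nth 0 s i == p) a i.
pose v := \sum_(i : 'I_(size s) | nth 0 s i != p) a i.
have wv : w + v = 1 by rewrite -a1 (bigID (fun i : 'I_(size s) => nth 0 s i == p))/=.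
have w0 : 0 <= w by apply: sumr_ge0.
have v0 : 0 <= v by apply: sumr_ge0.
have xE' : x = w *: p + \sum_(i : 'I_(size s) | nth 0 s i != p) a i *: nth 0 s i.
  rewrite xE (bigID (fun i : 'I_(size s) => nth 0 s i == p))/=; congr (_ + _).
  by rewrite scaler_suml; apply: eq_bigr => i /eqP ->.
have vN0 : v != 0.
  apply: contra xp => /eqP v0E; have {}wv : w = 1 by rewrite -wv v0E addr0.
  rewrite xE' wv scale1r big1 ?addr0// => i ip.
  have /eqP := v0E; rewrite psumr_eq0// => /allP/(_ i (mem_index_enum i)).
  by rewrite ip/= => /eqP ->; rewrite scale0r.
have v_gt0 : 0 < v by rewrite lt0r vN0.
exists w, (\sum_(i < size s) ((if nth 0 s i != p then a i / v else 0) *: nth 0 s i)).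
split => //; first by rewrite -wv ltrDl.
  apply: conv_hull_fin => [i||i]; first by case: ifP => // _; rewrite divr_ge0.
    by rewrite -big_mkcond/= -big_distrl/= mulfV.
  by case: ifP => [ip _|_]; rewrite ?eqxx//; apply: h => //; rewrite mem_nth.
rewrite xE' -wv addrAC subrr add0r; congr (_ + _).
rewrite scaler_sumr [LHS]big_mkcond/=; apply: eq_bigr => i _.
by case: ifP => _; rewrite ?scale0r ?scaler0// scalerA mulrCA mulfV// mulr1.
Qed.

End ConvexGeometry.

(** Take two opposite points of the cube on the diagonal line through [p]. Splitting off the weight
    of [p] pushes each of them further from [p] along the same ray, into the hull of [s']; hence [p]
    lies between two points of that hull. The positive dimension provides the diagonal direction. *)
Lemma conv_hull_remove (R : realType) (d : nat) (s s' : seq 'rV[R]_d.+1) p e :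
  0 < e -> cube p e `<=` conv_hull s ->
  (forall y, y \in s -> y != p -> conv_hull s' y) ->
  conv_hull s `<=` conv_hull s'.
Proof.
move=> e0 pe h.
suff ps' : conv_hull s' p.
  by apply: conv_hull_sub => y ys; have [->//|/(h _ ys)] := eqVneq y p.
have key (b : R) : `|b| = e -> exists2 k, 0 < k & conv_hull s' (p + (k * b) *: const_mx 1).
  move=> be.
  have [||a [u [a0 a1 us E]]] := @conv_hull_split _ _ s s' p (p + b *: const_mx 1) h.
  - by apply: pe => i; rewrite !mxE mulr1 addrAC subrr add0r be.
  - apply/eqP => /rowP/(_ ord0); rewrite !mxE mulr1 => /eqP.
    by rewrite -[eqbRHS]addr0 (inj_eq (addrI _)) -normr_eq0 be gt_eqF.
  exists (1 - a)^-1; first by rewrite invr_gt0 subr_gt0.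
  suff -> : p + ((1 - a)^-1 * b) *: const_mx 1 = u by [].
  have a1' : 1 - a != 0 by rewrite subr_eq0 gt_eqF.
  apply: (scalerI a1'); rewrite scalerDr scalerA mulrA mulfV// mul1r.
  apply: (addrI (a *: p)); rewrite -E addrA -scalerDl addrCA subrr addr0 scale1r.
  by [].
have [k1 k10 h1] := key e (gtr0_norm e0).
have [k2 k20 h2] := key (- e) (etrans (normrN _) (gtr0_norm e0)).
have k12 : k1 + k2 != 0 by rewrite gt_eqF// addr_gt0.
set q1 := p + _ in h1; set q2 := p + _ in h2.
(* The offsets of [q1] and [q2] from [p] are [k1 * e] and [- k2 * e] along the diagonal, so the
   weights are proportional to [k2] and [k1]. *)
suff -> : p = (k2 / (k1 + k2)) *: q1 + (1 - k2 / (k1 + k2)) *: q2.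
  apply: conv_hull_conv => //.
  apply/andP; split; first by rewrite divr_ge0 ?addr_ge0 ?ltW.
  by rewrite ler_pdivrMr ?addr_gt0// mul1r lerDr ltW.
by apply/rowP => i; rewrite /q1 /q2 !mxE; field; exact: k12.
Qed.

(** * Coverings by cubes and the boundary of a polytope *)

Section Covers.
Variables (R : realType) (d : nat).
Implicit Types (s t : seq 'rV[R]_d) (x y c p : 'rV[R]_d) (r e rho : R).

Lemma interval_cover5 (u rho : R) : `|u| <= rho ->
  exists k : 'I_5, `|u - (2 * rho / 5) * ((k : nat)%:R - 2)| <= rho / 5.
Proof.
rewrite ler_norml => /andP[h1 h2].
have H (k : nat) (k5 : (k < 5)%N) :
    (2 * k%:R - 5) * (rho / 5) <= u <= (2 * k%:R - 3) * (rho / 5) ->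
    exists k : 'I_5, `|u - (2 * rho / 5) * ((k : nat)%:R - 2)| <= rho / 5.
  by move=> h; exists (Ordinal k5); rewrite ler_norml /=; apply/andP; split; lra.
have [a1|a1] := lerP u (- 3 * (rho / 5)); first by apply: (H 0%N) => //; lra.
have [a2|a2] := lerP u (- (rho / 5)); first by apply: (H 1%N) => //; lra.
have [a3|a3] := lerP u (rho / 5); first by apply: (H 2%N) => //; lra.
have [a4|a4] := lerP u (3 * (rho / 5)); first by apply: (H 3%N) => //; lra.
by apply: (H 4%N) => //; lra.
Qed.

Definition subcube_center c rho (k : {ffun 'I_d -> 'I_5}) : 'rV[R]_d :=
  c + \row_i ((2 * rho / 5) * ((k i : nat)%:R - 2)).

Lemma subcube_cover c rho x : cube c rho x ->
  exists k, cube (subcube_center c rho k) (rho / 5) x.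
Proof.
move=> h; have /choice[f hf] := fun i => interval_cover5 (h i).
exists [ffun i => f i] => i; rewrite !mxE ffunE opprD addrA; exact: hf.
Qed.

(** Either some subcube misses the hull, or all meet it. In the latter case every point of the cube
    is within [2 * rho / 5] of the hull, cancellation leaves a cube of radius [3 * rho / 5] in the
    hull, and the central subcube is interior. With three pieces per side the remaining cube would
    be the central subcube itself, without margin. *)
Lemma subcube_porous s c rho : 0 < rho ->
  exists k, forall x, cube (subcube_center c rho k) (rho / 5) x ->
    conv_hull s x -> interior (conv_hull s) x.
Proof.
move=> rho0.
have [h|/existsNP[k hk]] := pselect (forall k, exists2 x, conv_hull s x &
    cube (subcube_center c rho k) (rho / 5) x); last first.
  by exists k => x kx sx; case: hk; exists x.
have sub : cube c (rho - (rho / 5 + rho / 5)) `<=` conv_hull s.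
  apply: conv_hull_cancel => [|y /subcube_cover[k yk]].
    by rewrite addr_ge0 ?divr_ge0// ltW.
  have [x sx xk] := h k; exists x => //.
  exact: cube_trans (cube_sym xk) yk.
(* Index 2 is the middle of [0..4] in each coordinate, so this subcube is centered at [c]. *)
exists [ffun=> inord 2] => x.
have -> : subcube_center c rho [ffun=> inord 2] = c.
  by apply/rowP => i; rewrite !mxE ffunE inordK// subrr mulr0 addr0.
move=> cx _; apply/interiorP; exists (rho / 5); first by rewrite divr_gt0.
move=> y xy; apply: sub; apply: cube_le (cube_trans cx xy); lra.
Qed.

(** Each cube of one generation is refined separately. Used with all [5 ^ d] subcubes to get finite
    nets, and with one subcube fewer for the boundary of a hull. *)
Lemma cover_iter (A : set 'rV[R]_d) (N : nat) :
  (forall c rho, 0 < rho -> exists2 t : seq 'rV[R]_d, (size t <= N)%N &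
    forall x, A x -> cube c rho x -> exists2 c', c' \in t & cube c' (rho / 5) x) ->
  forall n c rho, 0 < rho -> exists2 t : seq 'rV[R]_d, (size t <= N ^ n)%N &
    forall x, A x -> cube c rho x -> exists2 c', c' \in t & cube c' (rho / 5 ^+ n) x.
Proof.
move=> H n c rho rho0; elim: n => [|n [t st ht]].
  by exists [:: c] => // x _ cx; exists c; rewrite ?mem_head// expr0 divr1.
have rn0 : 0 < rho / 5 ^+ n by rewrite divr_gt0// exprn_gt0.
have /choice[f hf] : forall c', exists t', (size t' <= N)%N /\
    forall x, A x -> cube c' (rho / 5 ^+ n) x ->
      exists2 c'', c'' \in t' & cube c'' (rho / 5 ^+ n.+1) x.
  move=> c'; have [t' st' ht'] := H c' _ rn0; exists t'; split=> // x Ax xc.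
  have [c'' ? ?] := ht' _ Ax xc; exists c'' => //.
  by rewrite exprSr invfM mulrA.
exists (flatten [seq f c' | c' <- t]).
  rewrite expnSr (leq_trans _ (leq_mul st (leqnn N)))//.
  elim: (t) => //= a t' ih; rewrite size_cat mulSn leq_add//.
  by case: (hf a).
move=> x Ax /(ht _ Ax)[c' ct' xc'].
have [_ /(_ _ Ax xc')[c'' c''f xc'']] := hf c'.
exists c'' => //; apply/flattenP; exists (f c') => //; exact: map_f.
Qed.

Lemma cube_cover rho e : 0 < rho -> 0 < e ->
  exists t : seq 'rV[R]_d, forall x, cube 0 rho x ->
    exists2 c, c \in t & cube c e x.
Proof.
move=> rho0 e0.
have [n hn] : exists n, rho / 5 ^+ n <= e.
  exists (`|Num.ceil (rho / e)|)%N.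
  rewrite ler_pdivrMr ?exprn_gt0// -ler_pdivrMl// mulrC.
  have c0 : (0 <= Num.ceil (rho / e)) by rewrite ceil_ge0 (@lt_le_trans _ _ 0) ?divr_ge0// ltW.
  apply: (le_trans (ceil_ge _)); rewrite -[leLHS](ger0_norm) ?ler0z//.
  rewrite -intr_norm -natr_absz -natrX ler_nat.
  by apply: ltnW; exact: ltn_expl.
have [c r r0|t _ ht] := @cover_iter setT (5 ^ d) _ n 0 rho rho0.
  exists [seq subcube_center c r k | k in {ffun 'I_d -> 'I_5}].
    by rewrite size_map -cardE card_ffun !card_ord.
  by move=> x _ /subcube_cover[k xk]; exists (subcube_center c r k) => //;
    apply: map_f; rewrite mem_enum.
by exists t => x xr; have [//|c ct xc] := ht x _ xr; exists c => //; exact: cube_le xc.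
Qed.

Lemma boundary_cover s n c rho : 0 < rho ->
  exists2 t : seq 'rV[R]_d, (size t <= (5 ^ d).-1 ^ n)%N &
  forall x, conv_hull s x -> ~ interior (conv_hull s) x -> cube c rho x ->
    exists2 c', c' \in t & cube c' (rho / 5 ^+ n) x.
Proof.
move=> rho0.
have [c' r r0|t st ht] := @cover_iter (conv_hull s `\` interior (conv_hull s))
    (5 ^ d).-1 _ n c rho rho0.
  have [k0 hk0] := @subcube_porous s c' r r0.
  exists [seq subcube_center c' r k | k in predC1 k0].
    by rewrite size_map -cardE cardC1 card_ffun !card_ord.
  move=> x [sx nsx] /subcube_cover[k xk]; exists (subcube_center c' r k) => //.
  apply: map_f; rewrite mem_enum inE; apply/eqP => kE; apply: nsx.
  by apply: hk0 => //; rewrite -kE.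
by exists t => // x sx nsx xc; have [] := ht x (conj sx nsx) xc => c'; exists c'.
Qed.

End Covers.

Lemma conv_hull_boundary_null (R : realType) (d : nat) (s : seq 'rV[R]_d.+1) :
  lebesgue_null (conv_hull s `\` interior (conv_hull s)).
Proof.
move=> e e0; have [rho rho0 srho] := seq_bounded s.
set D := d.+1; set N := (5 ^ D)%N.
(* The factor by which the covered volume shrinks per generation: one subcube out of [N] is
   dropped. *)
pose q : R := N.-1%:R / N%:R.
have N0 : (0 < N)%N by rewrite expn_gt0.
have q1 : `|q| < 1.
  rewrite ger0_norm ?divr_ge0// ltr_pdivrMr ?ltr0n// mul1r ltr_nat.
  by rewrite prednK.
have [n hn] : exists n, (2 * rho) ^+ D * q ^+ n <= e.
  have K0 : 0 < (2 * rho) ^+ D by rewrite exprn_gt0// mulr_gt0.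
  have /cvgrPdist_le/(_ (e / (2 * rho) ^+ D)) : q ^+ n @[n --> \oo] --> (0 : R).
    exact: cvg_expr.
  rewrite divr_gt0// => /(_ isT)[n _ /(_ n (leqnn n))/=].
  rewrite sub0r normrN => h; exists n; rewrite -ler_pdivlMl// mulrC.
  exact: le_trans (ler_norm _) h.
have [t st ht] := @boundary_cover _ _ s n 0 rho rho0.
set r := rho / 5 ^+ n in ht.
have r0 : 0 < r by rewrite divr_gt0// exprn_gt0.
(* Indices past the end of [t] get the degenerate box at the origin, whose volume is zero because
   the dimension is positive. *)
pose corner (z : R) k := if (k < size t)%N then nth 0 t k + z *: const_mx 1 else 0.
exists (corner (- r)), (corner r); split; [|split].
- by move=> k i; rewrite /corner; case: ifP => // _; rewrite !mxE !mulr1 lerD2l; move: r0; lra.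
- move=> x [sx nsx]; have [c ct xc] := ht x sx nsx (conv_hull_cube srho sx).
  exists (index c t) => // i; rewrite /corner index_mem ct nth_index// !mxE !mulr1.
  by have := xc i; rewrite ler_distl.
- have vol k : box_vol (corner (- r) k) (corner r k) =
      if (k < size t)%N then (2 * r) ^+ D else 0.
    rewrite /box_vol /corner; case: ifP => _; last first.
      by rewrite big_ord_recl mxE subrr mul0r.
    rewrite (eq_bigr (fun=> 2 * r)) ?prodr_const ?card_ord// => i _.
    by rewrite !mxE; ring.
  move=> M; have -> : \sum_(k < M) box_vol (corner (- r) k) (corner r k) =
      (minn M (size t))%:R * (2 * r) ^+ D.
    elim: M => [|M ih]; first by rewrite big_ord0 min0n mul0r.
    rewrite big_ord_recr/= ih vol; case: ltnP => h.
      by rewrite (minn_idPl h) -[M.+1%:R]natr1; ring.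
    by rewrite addr0 (minn_idPr (leqW h)).
  apply: le_trans hn; apply: (@le_trans _ _ (N.-1%:R ^+ n * (2 * r) ^+ D)).
    apply: ler_wpM2r; first by rewrite exprn_ge0// mulr_ge0// ltW.
    by rewrite -natrX ler_nat (leq_trans (geq_minr _ _)).
  rewrite /r /q /N natrX expr_div_n mulrA !exprMn exprVn -!exprM mulnC.
  by rewrite le_eqVlt; apply/orP; left; apply/eqP; ring.
Qed.

(** * Deep cells *)

Section DiscreteHull.
Variables (R : realType) (d m : nat) (c : 'I_m -> 'rV[R]_d.+1) (r : R).
Hypothesis r0 : 0 < r.
Implicit Types O V S : {set 'I_m}.

Definition centers O : seq 'rV[R]_d.+1 := [seq c j | j <- enum O].

(** [O] stands for the set of occupied cells. A deep cell need not belong to [O]: empty cells inside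
    the hull count too, as the union of deep cells has to fill the interior. *)
Definition deep O : {set 'I_m} :=
  [set j | `[< cube (c j) r `<=` conv_hull (centers O) >]].

Lemma deepP O j : reflect (cube (c j) r `<=` conv_hull (centers O)) (j \in deep O).
Proof. by rewrite inE; exact: asboolP. Qed.

Lemma centersP O x : reflect (exists2 j, j \in O & x = c j) (x \in centers O).
Proof.
apply: (iffP mapP) => -[j jO xE]; exists j => //; first by rewrite -mem_enum.
by rewrite mem_enum.
Qed.

Lemma centers_mono O V : O \subset V ->
  conv_hull (centers O) `<=` conv_hull (centers V).
Proof.
move=> /fintype.subsetP OV; apply: conv_hull_sub => x /centersP[j jO ->].
by apply: conv_hull_mem; apply/centersP; exists j => //; exact: OV.
Qed.

Lemma deep_mono O V : O \subset V -> deep O \subset deep V.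
Proof.
move=> OV; apply/fintype.subsetP => j /deepP h; apply/deepP => y /h.
exact: centers_mono.
Qed.

(** Deep centers are removed one at a time. At each stage the hull is still at least that of [O], so
    the cube around the next deep center still lies in it and [conv_hull_remove] applies again. *)
Lemma deep_removable O : conv_hull (centers O) `<=` conv_hull (centers (O :\: deep O)).
Proof.
suff H (l : seq 'I_m) : {subset l <= deep O} ->
    conv_hull (centers O) `<=` conv_hull (centers (O :\: [set j in l])).
  apply: subset_trans (H (enum (deep O)) _) _; first by move=> j; rewrite mem_enum.
  by apply: centers_mono; apply: finset.setDS; apply/fintype.subsetP => j jd; rewrite inE mem_enum.
elim: l => [_|j l ih hl].
  by apply: centers_mono; apply/fintype.subsetP => j jO; rewrite !inE.
have ih' : conv_hull (centers O) `<=` conv_hull (centers (O :\: [set k in l])).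
  by apply: ih => k kl; apply: hl; rewrite inE kl orbT.
apply: (subset_trans ih').
apply: (@conv_hull_remove _ _ _ _ (c j) r) => //.
  apply: subset_trans ih'; apply/deepP/hl; exact: mem_head.
move=> y /centersP[k + ->] kj; rewrite !inE => /andP[kl kO].
apply: conv_hull_mem; apply/centersP; exists k => //; rewrite !inE kO andbT.
by rewrite negb_or kl andbT; apply: contra kj => /eqP ->.
Qed.

Lemma deep_setD O : deep (O :\: deep O) = deep O.
Proof.
apply/eqP; rewrite finset.eqEsubset deep_mono ?finset.subsetDl//=.
by apply/fintype.subsetP => j /deepP h; apply/deepP => y /h; exact: deep_removable.
Qed.

(** By monotonicity all of [S] is deep for [V :|: S]. By [deep_setD] the deep cells may be dropped
    before computing depth, and what is left lies in [V]. *)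
Lemma deep_setU V S : V :&: deep V = finset.set0 -> S \subset deep V ->
  deep (V :|: S) = deep V.
Proof.
move=> V0 SV; apply/eqP; rewrite finset.eqEsubset andbC deep_mono ?finset.subsetUl//=.
rewrite -deep_setD deep_mono//.
have := deep_mono (finset.subsetUl V S) => /fintype.subsetP h.
apply/fintype.subsetP => j; rewrite !inE => /andP[jn /orP[//|jS]].
by move/negP: jn; case; have := h _ (fintype.subsetP SV _ jS); rewrite inE.
Qed.

(** For fixed [V] the right-hand side constrains the cells one by one, although the residue depends
    on all of [O]. Conversely, such an [O] is [V] together with cells of [deep V], which do not
    change depth. *)
Lemma deep_residueE O V : (O :\: deep O == V) =
  [&& V :&: deep V == finset.set0, V \subset O & O \subset V :|: deep V].
Proof.
apply/idP/idP => [/eqP <-|/and3P[/eqP V0 VO OV]].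
  rewrite deep_setD finset.subsetDl; apply/andP; split; last first.
    by apply/fintype.subsetP => j jO; rewrite finset.in_setU finset.in_setD jO andbT orNb.
  apply/eqP/setP => j; rewrite finset.in_setI finset.in_setD finset.in_set0.
  by case: (j \in deep O); rewrite ?andbF.
have OE : O = V :|: (O :&: deep V).
  apply/setP => j; rewrite finset.in_setU finset.in_setI.
  have := fintype.subsetP OV j; have := fintype.subsetP VO j; rewrite finset.in_setU.
  by case: (j \in O); case: (j \in V) => //= [] ; [move=> _ /(_ isT)->|move=> /(_ isT)].
have dE : deep O = deep V by rewrite OE deep_setU// finset.subsetIr.
rewrite dE; apply/eqP/setP => j; rewrite finset.in_setD.
have := fintype.subsetP OV j; have := fintype.subsetP VO j; rewrite finset.in_setU.
have : ~~ ((j \in V) && (j \in deep V)) by rewrite -finset.in_setI V0 finset.in_set0.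
case: (j \in O); case: (j \in V) => //=; case: (j \in deep V) => //=.
- by move=> _ _ /(_ isT).
- by move=> _ /(_ isT).
Qed.

End DiscreteHull.

(** * Deep cells compared with the interior of the polytope *)

Section DiscreteApproximation.
Variables (R : realType) (d m : nat) (c : 'I_m -> 'rV[R]_d.+1) (e rho : R).
Variables (A : 'I_m -> set 'rV[R]_d.+1) (s : seq 'rV[R]_d.+1).
Hypothesis e0 : 0 < e.
Hypothesis Ac : forall j, A j `<=` cube (c j) e.

Definition occupied : {set 'I_m} := [set j | (0 < npoints s (A j))%N].

Lemma occupiedP j : reflect (exists2 x, x \in s & A j x) (j \in occupied).
Proof.
rewrite inE /npoints -has_count; apply: (iffP hasP) => -[x xs /asboolP Ax];
  by exists x => //; apply/asboolP.
Qed.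

(** Of the radius [3 * e], one [e] is lost in passing from centers to points of [s], one in moving
    from [c j] to [x], and the last one is the neighbourhood of [x]. *)
Lemma deep_sub_interior j x : j \in deep c (3 * e) occupied -> A j x ->
  interior (conv_hull s) x.
Proof.
move=> /deepP jd jx; apply/interiorP; exists e => //.
apply: subset_trans (_ : cube (c j) (3 * e - e) `<=` _).
  by move=> y xy; apply: cube_le (cube_trans (Ac jx) xy); lra.
apply: conv_hull_cancel; first exact: ltW.
move=> y /jd; apply: conv_hull_approx => x' /centersP[k /occupiedP[z zs kz] ->].
by exists z; [exact: conv_hull_mem|apply: cube_sym; exact: Ac].
Qed.

(** The constant 5 is the sum of the depth [3 * e], of [e] for moving from [x] to the center of its
    cell, and of [e] for replacing points by centers. *)
Lemma interior_sub_deep x r : (forall y, y \in s -> exists j, A j y) ->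
  5 * e <= r -> cube x r `<=` conv_hull s ->
  forall j, A j x -> j \in deep c (3 * e) occupied.
Proof.
move=> sA er xs j jx; apply/deepP.
apply: subset_trans (_ : cube x (r - e) `<=` _).
  by move=> y cy; apply: cube_le (cube_trans (cube_sym (Ac jx)) cy); lra.
apply: conv_hull_cancel; first exact: ltW.
move=> y /xs; apply: conv_hull_approx => x' xs'; have [k kx'] := sA _ xs'.
exists (c k); last exact: Ac.
apply: conv_hull_mem; apply/centersP; exists k => //.
by apply/occupiedP; exists x'.
Qed.

End DiscreteApproximation.

(** * The complex exponential *)

Section ExponentialSums.
Variable F : numFieldType.
Implicit Types x y : F.

(** Stated over a numeric field so that the sums in [R[i]] and in [R] are instances of one object,
    linked by [exp_sum_real]. *)
Definition exp_sum x M : F := \sum_(n < M) x ^+ n / (n`!)%:R.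

Let natr_fact_neq0 n : (n`!)%:R != 0 :> F.
Proof. by rewrite pnatr_eq0 -lt0n fact_gt0. Qed.

Lemma exp_term_add x y n : (x + y) ^+ n / (n`!)%:R =
  \sum_(i < n.+1) x ^+ i / (i`!)%:R * (y ^+ (n - i) / ((n - i)`!)%:R).
Proof.
rewrite addrC exprDn mulr_suml; apply: eq_bigr => -[i i_lt] _ /=.
have le_in : (i <= n)%N by [].
have := bin_fact le_in => /(congr1 (fun k => k%:R : F)); rewrite !natrM => E.
rewrite -E -mulr_natr; field.
rewrite !natr_fact_neq0 /=.
by rewrite pnatr_eq0 -lt0n bin_gt0.
Qed.

Lemma exp_sum_add x y M :
  exp_sum (x + y) M = \sum_(i < M) x ^+ i / (i`!)%:R * exp_sum y (M - i).
Proof.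
elim: M => [|M ih]; first by rewrite /exp_sum !big_ord0.
rewrite /exp_sum big_ord_recr/= -/(exp_sum _ M) ih exp_term_add [in RHS]big_ord_recr/=.
rewrite [in X in _ + X]big_ord_recr/= addrA subnn -big_split/=; congr (_ + _).
  apply: eq_bigr => i _; rewrite -mulrDr; congr (_ * _).
  by rewrite subSn 1?ltnW// big_ord_recr.
by rewrite subSnn big_ord_recr big_ord0/= add0r.
Qed.

Lemma exp_sum_mul_sub x y M : exp_sum x M * exp_sum y M - exp_sum (x + y) M =
  \sum_(i < M) x ^+ i / (i`!)%:R * (exp_sum y M - exp_sum y (M - i)).
Proof.
rewrite exp_sum_add [in X in X - _]/exp_sum mulr_suml -sumrB.
by apply: eq_bigr => i _; rewrite mulrBr.
Qed.

Lemma exp_sum_diff y M k : exp_sum y M - exp_sum y (M - k) =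
  \sum_(M - k <= n < M) y ^+ n / (n`!)%:R.
Proof.
rewrite /exp_sum -!(big_mkord predT (fun n => y ^+ n / (n`!)%:R)).
by rewrite (big_cat_nat (leq0n _) (leq_subr k M))/= addrAC subrr add0r.
Qed.

(* The Cauchy product remainder is majorized by its value at the norms. *)
Lemma exp_sum_mul_le x y M :
  `|exp_sum x M * exp_sum y M - exp_sum (x + y) M| <=
  exp_sum `|x| M * exp_sum `|y| M - exp_sum (`|x| + `|y|) M.
Proof.
rewrite !exp_sum_mul_sub (le_trans (ler_norm_sum _ _ _))//.
apply: ler_sum => i _; rewrite normrM normrM normfV normrX normr_nat.
rewrite ler_wpM2l// ?divr_ge0//.
rewrite !exp_sum_diff (le_trans (ler_norm_sum _ _ _))//.
by apply: ler_sum => n _; rewrite normrM normfV normrX normr_nat.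
Qed.

End ExponentialSums.

(** * Modulus, complex limits and the exponential series *)

Section ComplexLimits.
Variable R : realType.
Implicit Types (z w : R[i]) (u v : nat -> R[i]).

(** The norm of [R[i]] takes values in [R[i]]; this identity carries its properties over to the
    real-valued [cabs]. *)
Lemma norm_cabs z : `|z| = Complex (cabs z) 0.
Proof. exact: normc_def. Qed.

Lemma cabs_ge0 z : 0 <= cabs z. Proof. exact: sqrtr_ge0. Qed.

Lemma cabsM z w : cabs (z * w) = cabs z * cabs w.
Proof.
have := normrM z w; rewrite !norm_cabs => -[->].
by rewrite !mulr0 subr0.
Qed.

Lemma cabsD z w : cabs (z + w) <= cabs z + cabs w.
Proof.
have := ler_normD z w; rewrite !norm_cabs.
by rewrite -[Complex _ _ + _]/(Complex (cabs z + cabs w) (0 + 0)) addr0 lecR.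
Qed.

Lemma cabsN z : cabs (- z) = cabs z.
Proof. by have := normrN z; rewrite !norm_cabs => -[]. Qed.

Lemma cabs_eq0 z : (cabs z == 0) = (z == 0).
Proof. by rewrite -[z == 0]normr_eq0 norm_cabs eq_complex/= eqxx andbT. Qed.

Lemma cabs0 : cabs (0 : R[i]) = 0.
Proof. by apply/eqP; rewrite cabs_eq0. Qed.

Lemma cabs_real (x : R) : cabs (Complex x 0) = `|x|.
Proof. by rewrite /cabs /= expr0n/= addr0 sqrtr_sqr. Qed.

Lemma cabs1 : cabs (1 : R[i]) = 1.
Proof. by rewrite -[1]/(Complex 1 0) cabs_real normr1. Qed.

Lemma cabsX z n : cabs (z ^+ n) = cabs z ^+ n.
Proof. by elim: n => [|n ih]; rewrite ?expr0 ?cabs1// !exprS cabsM ih. Qed.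

Lemma cabsV z : cabs z^-1 = (cabs z)^-1.
Proof.
have [->|z0] := eqVneq z 0; first by rewrite invr0 cabs0 invr0.
apply: (mulfI (x := cabs z)); first by rewrite cabs_eq0.
by rewrite -cabsM !mulfV ?cabs1// cabs_eq0.
Qed.

Lemma normRe_cabs z : `|cRe z| <= cabs z.
Proof. by have := normc_ge_Re z; rewrite norm_cabs lecR. Qed.

Lemma normIm_cabs z : `|cIm z| <= cabs z.
Proof.
by rewrite -sqrtr_sqr ler_wsqrtr// lerDr sqr_ge0.
Qed.

Lemma cabs_ReIm z : cabs z <= `|cRe z| + `|cIm z|.
Proof.
case: z => x y /=; rewrite -[Complex x y](_ : Complex x 0 + Complex 0 y = _).
  rewrite (le_trans (cabsD _ _))// cabs_real lerD2l.
  by rewrite /cabs /= expr0n/= add0r sqrtr_sqr.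
by rewrite -[LHS]/(Complex (x + 0) (0 + y)) addr0 add0r.
Qed.

Lemma cReD z w : cRe (z + w) = cRe z + cRe w. Proof. by case: z; case: w. Qed.
Lemma cImD z w : cIm (z + w) = cIm z + cIm w. Proof. by case: z; case: w. Qed.
Lemma cReN z : cRe (- z) = - cRe z. Proof. by case: z. Qed.
Lemma cImN z : cIm (- z) = - cIm z. Proof. by case: z. Qed.
Lemma cReM z w : cRe (z * w) = cRe z * cRe w - cIm z * cIm w.
Proof. by case: z; case: w. Qed.
Lemma cImM z w : cIm (z * w) = cRe z * cIm w + cIm z * cRe w.
Proof. by case: z => a b; case: w => c d. Qed.
Lemma complex_eq z w : cRe z = cRe w -> cIm z = cIm w -> z = w.
Proof. by case: z => a b; case: w => c d /= -> ->. Qed.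

(** Componentwise, to match [cexpect], which integrates real and imaginary parts separately. *)
Definition ccvg u z :=
  (cRe (u n) @[n --> \oo] --> cRe z) /\ (cIm (u n) @[n --> \oo] --> cIm z).

Lemma ccvg_cst z : ccvg (fun=> z) z.
Proof. by split; exact: cvg_cst. Qed.

Lemma ccvgD u v z w : ccvg u z -> ccvg v w -> ccvg (fun n => u n + v n) (z + w).
Proof.
move=> [u1 u2] [v1 v2]; split.
  by rewrite cReD; under eq_fun do rewrite cReD; exact: cvgD.
by rewrite cImD; under eq_fun do rewrite cImD; exact: cvgD.
Qed.

Lemma ccvgM u v z w : ccvg u z -> ccvg v w -> ccvg (fun n => u n * v n) (z * w).
Proof.
move=> [u1 u2] [v1 v2]; split.
  by rewrite cReM; under eq_fun do rewrite cReM; apply: cvgB; exact: cvgM.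
by rewrite cImM; under eq_fun do rewrite cImM; apply: cvgD; exact: cvgM.
Qed.

Lemma ccvg_unique u z w : ccvg u z -> ccvg u w -> z = w.
Proof.
move=> [u1 u2] [v1 v2]; apply: complex_eq.
  exact: (cvg_unique _ u1 v1).
exact: (cvg_unique _ u2 v2).
Qed.

Lemma ccvg_sum (I : Type) (r : seq I) (Q : pred I) (f : I -> nat -> R[i]) g :
  (forall i, Q i -> ccvg (f i) (g i)) ->
  ccvg (fun n => \sum_(i <- r | Q i) f i n) (\sum_(i <- r | Q i) g i).
Proof.
move=> h; elim: r => [|i r ih].
  by rewrite big_nil; under eq_fun do rewrite big_nil; exact: ccvg_cst.
rewrite big_cons; under eq_fun do rewrite big_cons.
by case: ifP => // Qi; apply: ccvgD => //; exact: h.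
Qed.

Lemma ccvg_prod (I : Type) (r : seq I) (Q : pred I) (f : I -> nat -> R[i]) g :
  (forall i, Q i -> ccvg (f i) (g i)) ->
  ccvg (fun n => \prod_(i <- r | Q i) f i n) (\prod_(i <- r | Q i) g i).
Proof.
move=> h; elim: r => [|i r ih].
  by rewrite big_nil; under eq_fun do rewrite big_nil; exact: ccvg_cst.
rewrite big_cons; under eq_fun do rewrite big_cons.
by case: ifP => // Qi; apply: ccvgM => //; exact: h.
Qed.

Lemma ccvg_squeeze u z (a : nat -> R) : (forall n, cabs (u n - z) <= a n) ->
  a n @[n --> \oo] --> 0 -> ccvg u z.
Proof.
move=> h a0; have na0 : - a n @[n --> \oo] --> 0 by rewrite -oppr0; exact: cvgN.
split; apply/subr_cvg0.
  apply: (squeeze_cvgr _ na0 a0); near=> n; rewrite -ler_norml.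
  by rewrite -cReN -cReD (le_trans (normRe_cabs _)).
apply: (squeeze_cvgr _ na0 a0); near=> n; rewrite -ler_norml.
by rewrite -cImN -cImD (le_trans (normIm_cabs _)).
Unshelve. all: by end_near. Qed.

Lemma ccvg_near u v z : (\forall n \near \oo, u n = v n) -> ccvg u z -> ccvg v z.
Proof.
move=> uv [h1 h2]; split.
  by apply: cvg_trans h1; apply: near_eq_cvg; near do rewrite -(near uv _)//.
by apply: cvg_trans h2; apply: near_eq_cvg; near do rewrite -(near uv _)//.
Unshelve. all: by end_near. Qed.

Lemma exp_sum_cvgR (x : R) : exp_sum x n @[n --> \oo] --> expR x.
Proof.
have -> : (fun n => exp_sum x n) = series (exp_coeff x).
  by apply/funext => n; rewrite /series/= big_mkord.
exact: is_cvg_series_exp_coeff.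
Qed.

Lemma exp_sum_real (x : R) n : exp_sum (Complex x 0) n = Complex (exp_sum x n) 0.
Proof.
rewrite -[Complex _ _]/(real_complex R x) /exp_sum -[RHS]/(real_complex R _).
by rewrite rmorph_sum/=; apply: eq_bigr => i _; rewrite rmorphM/= rmorphXn/= fmorphV rmorph_nat.
Qed.

Lemma exp_sum_imag (y : R) n : exp_sum (Complex 0 y) n =
  Complex (series (cos_coeff y) n) (series (sin_coeff y) n).
Proof.
have term k : (Complex 0 y) ^+ k / (k`!)%:R = Complex (cos_coeff y k) (sin_coeff y k).
  have -> : (k`!)%:R^-1 = Complex ((k`!)%:R^-1) 0 :> R[i].
    by rewrite -[RHS]/(real_complex R _) fmorphV rmorph_nat.
  (* The parities encode the powers of the imaginary unit in the form of [cos_coeff] and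
     [sin_coeff]; at [k = 0] the truncated predecessor is masked by the factor [odd k]. *)
  have -> : Complex 0 y ^+ k = Complex ((~~ odd k)%:R * (-1) ^+ k./2 * y ^+ k)
      ((odd k)%:R * (-1) ^+ (k.-1)./2 * y ^+ k).
    elim: k => [|k ih]; first by rewrite !expr0 !mul0r !mulr1.
    have [ok|ok] := boolP (odd k).
      have kE : k = (k./2).*2.+1 by rewrite -[LHS]odd_double_half ok.
      move: (k./2) kE => h kE; rewrite kE /= odd_double /= in ih *.
      rewrite doubleK -/(_.*2.+2) in ih *.
      rewrite exprS ih; apply: complex_eq; rewrite ?cReM ?cImM/=.
        by rewrite uphalf_double !exprS; ring.
      by ring.
    have kE : k = (k./2).*2 by rewrite -[LHS]odd_double_half (negbTE ok).
    move: (k./2) kE => h kE; rewrite kE /= odd_double /= in ih *.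
    rewrite doubleK in ih *.
    rewrite exprS ih; apply: complex_eq; rewrite ?cReM ?cImM/=; first by ring.
    by rewrite exprS; ring.
  apply: complex_eq; rewrite ?cReM ?cImM/= ?mulr0 ?subr0 ?addr0 ?add0r.
    by rewrite /cos_coeff/= -exprnP.
  by rewrite /sin_coeff/=.
rewrite /exp_sum; under eq_bigr do rewrite term.
rewrite /series/= !big_mkord; elim: n => [|n ih]; first by rewrite !big_ord0.
by rewrite !big_ord_recr/= ih.
Qed.

(** Separate the real and imaginary parts of the argument. The Cauchy product remainder is majorized
    by the real one at [|x|] and [|y|], which tends to zero because [expR] is multiplicative. *)
Lemma exp_sum_ccvg z : ccvg (exp_sum z) (cexp z).
Proof.
have [x [y zE]] : exists x y, z = Complex x 0 + Complex 0 y.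
  by case: z => x y; exists x, y; apply: complex_eq => /=; rewrite ?addr0 ?add0r.
have h1 : ccvg (exp_sum (Complex x 0)) (Complex (expR x) 0).
  split; under eq_fun do rewrite exp_sum_real/=; first exact: exp_sum_cvgR.
  exact: cvg_cst.
have h2 : ccvg (exp_sum (Complex 0 y)) (Complex (cos y) (sin y)).
  split; under eq_fun do rewrite exp_sum_imag/=.
    by rewrite unlock; exact: is_cvg_series_cos_coeff.
  by rewrite /= unlock; exact: is_cvg_series_sin_coeff.
have cE : cexp z = Complex (expR x) 0 * Complex (cos y) (sin y).
  by apply: complex_eq; rewrite /cexp zE ?cReM ?cImM/= addr0 add0r mul0r ?subr0 ?addr0.
have h3 : ccvg (fun n => exp_sum z n -
    exp_sum (Complex x 0) n * exp_sum (Complex 0 y) n) 0.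
  apply: (@ccvg_squeeze _ _ (fun n => exp_sum `|x| n * exp_sum `|y| n
      - exp_sum (`|x| + `|y|) n)).
    move=> n; rewrite subr0 -cabsN opprB zE.
    have := exp_sum_mul_le (Complex x 0) (Complex 0 y) n.
    rewrite !norm_cabs !cabs_real.
    have -> : cabs (Complex 0 y) = `|y|.
      by rewrite /cabs/= expr0n/= add0r sqrtr_sqr.
    rewrite -[Complex `|x| 0 + _]/(Complex _ (0 + 0)) addr0 !exp_sum_real.
    rewrite lecE/= => /andP[_]; rewrite mul0r subr0; exact.
  rewrite -(subrr (expR `|x| * expR `|y|)) -{2}expRD.
  by apply: cvgB; [apply: cvgM|]; exact: exp_sum_cvgR.
rewrite cE -[X in ccvg _ X]add0r.
apply: ccvg_near (ccvgD h3 (ccvgM h1 h2)).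
by near=> n; rewrite subrK.
Unshelve. all: by end_near. Qed.

End ComplexLimits.

(** * Expectations of functions of independent counts *)

Section ComplexExpectation.
Context {R : realType} {dO : measure_display} {Omega : measurableType dO}.
Variable P : probability Omega R.
Implicit Types (X : Omega -> R[i]) (Y : Omega -> R).

(** The limit is not assumed measurable: it is so as a pointwise limit. Functionals of the polytope
    become integrable in this way. *)
Lemma dominated_cvg_Rintegral (f : nat -> Omega -> R) (f0 Y : Omega -> R) :
  (forall n, measurable_fun [set: Omega] (f n)) ->
  (forall w, f n w @[n --> \oo] --> f0 w) ->
  (forall n w, `|f n w| <= Y w) -> P.-integrable [set: Omega] (EFin \o Y) ->
  P.-integrable [set: Omega] (EFin \o f0) /\
  Rintegral P [set: Omega] (f n) @[n --> \oo] --> Rintegral P [set: Omega] f0.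
Proof.
move=> mf f0E fY iY.
have mf0 : measurable_fun [set: Omega] f0.
  by apply: (measurable_fun_cvg mf) => w _; exact: f0E.
have [||||| i0 _ h] := @dominated_convergence _ _ _ P [set: Omega] measurableT
    (fun n => EFin \o f n) (EFin \o f0) (EFin \o Y).
- by move=> n; apply/measurable_EFinP.
- exact/measurable_EFinP.
- by apply/aeW => w _ /=; apply: cvg_EFin; [near=> n|exact: f0E].
- exact: iY.
- by apply/aeW => w n _ /=; rewrite lee_fin.
split => //; apply: fine_cvg; rewrite fineK; first exact: h.
exact: integrable_fin_num.
Unshelve. all: by end_near. Qed.

Definition cmeasurable X :=
  measurable_fun [set: Omega] (fun w => cRe (X w)) /\
  measurable_fun [set: Omega] (fun w => cIm (X w)).

Lemma dominated_cvg_cexpect (X : nat -> Omega -> R[i]) (X0 : Omega -> R[i]) Y :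
  (forall n, cmeasurable (X n)) -> (forall w, ccvg (X^~ w) (X0 w)) ->
  (forall n w, cabs (X n w) <= Y w) -> P.-integrable [set: Omega] (EFin \o Y) ->
  cintegrable P X0 /\ ccvg (fun n => cexpect P (X n)) (cexpect P X0).
Proof.
move=> mX XX0 XY iY.
have [i1 h1] := @dominated_cvg_Rintegral (fun n w => cRe (X n w))
  (fun w => cRe (X0 w)) Y (fun n => (mX n).1) (fun w => (XX0 w).1)
  (fun n w => le_trans (normRe_cabs _) (XY n w)) iY.
have [i2 h2] := @dominated_cvg_Rintegral (fun n w => cIm (X n w))
  (fun w => cIm (X0 w)) Y (fun n => (mX n).2) (fun w => (XX0 w).2)
  (fun n w => le_trans (normIm_cabs _) (XY n w)) iY.
by split; split.
Qed.

Lemma Rintegral_simple (I : Type) (r : seq I) (a : I -> R) (B : I -> set Omega) :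
  (forall i, measurable (B i)) ->
  P.-integrable [set: Omega] (EFin \o (fun w => \sum_(i <- r) a i * \1_(B i) w)) /\
  Rintegral P [set: Omega] (fun w => \sum_(i <- r) a i * \1_(B i) w) =
  \sum_(i <- r) a i * fine (P (B i)).
Proof.
move=> mB.
have iB i : P.-integrable [set: Omega] (EFin \o \1_(B i)).
  by apply: integrable_indic => //; rewrite setTI// ltey_eq fin_num_measure.
have iaB i : P.-integrable [set: Omega] (EFin \o (fun w => a i * \1_(B i) w)).
  by have := integrableZl measurableT (a i) (iB i); apply: eq_integrable => // w _.
have E i : Rintegral P [set: Omega] (fun w => a i * \1_(B i) w) = a i * fine (P (B i)).
  by rewrite RintegralZl// /Rintegral integral_indic// setIT.
elim: r => [|i r [ih1 ih2]].
  under eq_fun do rewrite big_nil; rewrite big_nil; split; last by rewrite Rintegral_cst// mul0r.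
  exact: integrable0.
under eq_fun do rewrite big_cons; rewrite big_cons; split.
  have := integrableD measurableT (iaB i) ih1.
  by apply: eq_integrable => // w _ /=; rewrite EFinD.
by rewrite RintegralD// ih2 E.
Qed.

Lemma cexpect_simple (I : finType) (a : I -> R[i]) (B : I -> set Omega) :
  (forall i, measurable (B i)) ->
  cmeasurable (fun w => \sum_i a i * Complex (\1_(B i) w) 0) /\
  cexpect P (fun w => \sum_i a i * Complex (\1_(B i) w) 0) =
  \sum_i a i * Complex (fine (P (B i))) 0.
Proof.
move=> mB.
have ReS (b : I -> R) : cRe (\sum_i a i * Complex (b i) 0) = \sum_i cRe (a i) * b i.
  elim/big_rec2: _ => //= i x y _ <-.
  by rewrite cReD cReM/= mulr0 subr0.
have ImS (b : I -> R) : cIm (\sum_i a i * Complex (b i) 0) = \sum_i cIm (a i) * b i.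
  elim/big_rec2: _ => //= i x y _ <-.
  by rewrite cImD cImM/= mulr0 add0r.
have [i1 e1] := Rintegral_simple (index_enum I) (fun i => cRe (a i)) mB.
have [i2 e2] := Rintegral_simple (index_enum I) (fun i => cIm (a i)) mB.
split.
  split.
    under eq_fun do rewrite ReS; exact/measurable_EFinP/(measurable_int P).
  under eq_fun do rewrite ImS; exact/measurable_EFinP/(measurable_int P).
apply: complex_eq; rewrite ?ReS ?ImS/=.
  by under eq_Rintegral do rewrite ReS.
by under eq_Rintegral do rewrite ImS.
Qed.

End ComplexExpectation.

(** * Functions of finitely many independent counts *)

Section DiscreteVariables.
Context {R : realType} {dO : measure_display} {Omega : measurableType dO}.
Variables (P : probability Omega R) (m : nat) (N : 'I_m -> Omega -> nat).
Variable p : 'I_m -> nat -> R.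
Hypothesis mN : forall j n, measurable [set w | N j w = n].
Hypothesis pN : forall n : 'I_m -> nat,
  P (\bigcap_(i in [set: 'I_m]) [set w | N i w = n i]) = (\prod_i p i (n i))%:E.

(** Restricting to the event that all counts are below [M] gives a simple function; dominated
    convergence then lets [M] grow. The truncation is the same for all cells, so the sum runs over a
    full box. *)
Lemma cexpect_discrete (F : ('I_m -> nat) -> R[i]) (Y : Omega -> R) :
  P.-integrable [set: Omega] (EFin \o Y) ->
  (forall w, cabs (F (N^~ w)) <= Y w) ->
  cintegrable P (fun w => F (N^~ w)) /\
  ccvg (fun M => \sum_(n : {ffun 'I_m -> 'I_M})
    F (fun i => n i) * Complex (\prod_i p i (n i)) 0) (cexpect P (fun w => F (N^~ w))).
Proof.
move=> iY FY.
pose B M (n : {ffun 'I_m -> 'I_M}) :=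
  \bigcap_(i in [set: 'I_m]) [set w | N i w = n i].
have mB M n : measurable (@B M n).
  by apply: fin_bigcap_measurable => // i _; exact: mN.
pose X M w : R[i] := \sum_(n : {ffun 'I_m -> 'I_M})
  F (fun i => n i) * Complex (\1_(B M n) w) 0.
have XE M w : X M w = if [forall i, N i w < M]%N then F (N^~ w) else 0.
  rewrite /X; case: ifPn => [/forallP h|].
    pose n0 : {ffun 'I_m -> 'I_M} := [ffun i => Ordinal (h i)].
    have Bn0 : B M n0 w by move=> i _ /=; rewrite ffunE.
    rewrite (bigD1 n0)//= big1 => [|n nn0].
      rewrite addr0 indicE mem_set// mulr1.
      by congr F; apply/funext => i; rewrite ffunE.
    rewrite indicE memNset ?mulr0// => Bn; move/eqP: nn0; apply.
    apply/ffunP => i; apply/val_inj; rewrite ffunE/=.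
    by rewrite -(Bn i Logic.I).
  move=> h; apply: big1 => n _; rewrite indicE memNset ?mulr0// => Bn.
  by move/negP: h; apply; apply/forallP => i; rewrite (Bn i Logic.I).
have [||||i h] := @dominated_cvg_cexpect R _ _ P X (fun w => F (N^~ w)) Y.
- by move=> M; have [] := cexpect_simple P (fun n : {ffun 'I_m -> 'I_M} => F (fun i => n i)) (mB M).
- move=> w; apply: ccvg_near (ccvg_cst (F (N^~ w))).
  near=> M; rewrite XE ifT//; apply/forallP => i.
  apply: (@leq_trans (\max_i N i w).+1); first by rewrite ltnS leq_bigmax.
  by near: M; exact: nbhs_infty_ge.
- move=> M w; rewrite XE; case: ifP => // _.
  by rewrite cabs0 (le_trans _ (FY w))// cabs_ge0.
- exact: iY.
split => //; apply: ccvg_near h; near=> M.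
have [_ ->] := cexpect_simple P (fun n : {ffun 'I_m -> 'I_M} => F (fun i => n i)) (mB M).
by apply: eq_bigr => n _; rewrite /B pN.
Unshelve. all: by end_near. Qed.

Variable D : {set 'I_m} -> {set 'I_m}.
Hypothesis D_idem : forall O, D (O :\: D O) = D O.
Hypothesis D_residue : forall O V : {set 'I_m}, (O :\: D O == V) =
  [&& V :&: D V == finset.set0, V \subset O & O \subset V :|: D V].

Definition support_of (n : 'I_m -> nat) : {set 'I_m} := [set j | (0 < n j)%N].

Definition deep_prod (phi : 'I_m -> nat -> R[i]) (n : 'I_m -> nat) : R[i] :=
  \prod_(j in D (support_of n)) phi j (n j).

Definition residue_factor (phi : 'I_m -> nat -> R[i]) (V : {set 'I_m}) (j : 'I_m) k : R[i] :=
  if j \in V then (0 < k)%N%:R else if j \in D V then phi j k else (k == 0)%N%:R.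

(* The event that the residue [O :\: D O] of the support [O] equals [V] is a
   product event: it only asks for [V] to be occupied and for the complement of
   [V :|: D V] to be empty. *)
Lemma residue_prod phi n (V : {set 'I_m}) : V :&: D V == finset.set0 ->
  \prod_j residue_factor phi V j (n j) =
  if support_of n :\: D (support_of n) == V then deep_prod phi n else 0.
Proof.
set O := support_of n => V0.
have memO j : (j \in O) = (0 < n j)%N by rewrite inE.
have VD j : j \in D V -> j \notin V.
  move=> jD; apply/negP => jV; have := finset.in_set0 j.
  by rewrite -(eqP V0) finset.in_setI jV jD.
case: ifPn; rewrite D_residue V0/=.
  move=> /[dup] /andP[/fintype.subsetP VO /fintype.subsetP OV] h.
  have DV : D O = D V.
    have : O :\: D O == V by rewrite D_residue V0.
    by move/eqP => <-; rewrite D_idem.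
  rewrite /deep_prod -/O DV (bigID (mem (D V)))/= [X in _ * X]big1 ?mulr1.
    apply: eq_bigr => j jD; by rewrite /residue_factor jD (negbTE (VD _ jD)).
  move=> j jD; rewrite /residue_factor (negbTE jD).
  case: ifPn => [/VO|jV]; first by rewrite memO => ->.
  have : j \notin O by apply/negP => /OV; rewrite finset.in_setU (negbTE jV) (negbTE jD).
  by rewrite memO -eqn0Ngt => ->.
rewrite negb_and => /orP[] /subsetPn[j].
  move=> jV; rewrite memO -eqn0Ngt => /eqP nj.
  by rewrite (bigD1 j)//= /residue_factor jV nj mul0r.
rewrite memO finset.in_setU negb_or => nj /andP[jV jD].
by rewrite (bigD1 j)//= /residue_factor (negbTE jV) (negbTE jD) gtn_eqF// mul0r.
Qed.

(** Exactly one term survives, that of the actual residue. The index set of [deep_prod] depends on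
    all counts at once; the right-hand side is a finite sum of products of functions of single
    counts. *)
Lemma deep_prod_residue phi n : deep_prod phi n =
  \sum_(V : {set 'I_m} | V :&: D V == finset.set0) \prod_j residue_factor phi V j (n j).
Proof.
set O := support_of n.
have V0 : (O :\: D O) :&: D (O :\: D O) == finset.set0.
  by have := D_residue O (O :\: D O); rewrite eqxx => /esym/and3P[].
rewrite (bigD1 (O :\: D O))//= residue_prod// eqxx big1 ?addr0// => V /andP[V0' VO].
by rewrite residue_prod// eq_sym (negbTE VO).
Qed.

Hypothesis p_cvg : forall j, exists l,
  ccvg (fun M => \sum_(k < M) Complex (p j k) 0) l.

(* Both expectations are the limit of the same expression in the sums
   [\sum_(k < M) phi j k * p j k]. *)
Lemma cexpect_deep_prod_eq (phi1 phi2 : 'I_m -> nat -> R[i]) (l : 'I_m -> R[i])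
    (Y1 Y2 : Omega -> R) :
  (forall j, ccvg (fun M => \sum_(k < M) phi1 j k * Complex (p j k) 0) (l j)) ->
  (forall j, ccvg (fun M => \sum_(k < M) phi2 j k * Complex (p j k) 0) (l j)) ->
  P.-integrable [set: Omega] (EFin \o Y1) ->
  (forall w, cabs (deep_prod phi1 (N^~ w)) <= Y1 w) ->
  P.-integrable [set: Omega] (EFin \o Y2) ->
  (forall w, cabs (deep_prod phi2 (N^~ w)) <= Y2 w) ->
  cexpect P (fun w => deep_prod phi1 (N^~ w)) = cexpect P (fun w => deep_prod phi2 (N^~ w)).
Proof.
move=> h1 h2 iY1 b1 iY2 b2.
have zero_cvg j : ccvg (fun M => \sum_(k < M) (k == 0 :> nat)%N%:R * Complex (p j k) 0)
    (Complex (p j 0%N) 0).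
  apply: ccvg_near (ccvg_cst _); near=> M.
  have -> : M = M.-1.+1 by rewrite prednK//; near: M; exact: nbhs_infty_gt.
  rewrite big_ord_recl/= mul1r big1 ?addr0// => k _.
  by rewrite mul0r.
have /choice[q hq] := p_cvg.
have pos_cvg j : ccvg (fun M => \sum_(k < M) (0 < k)%N%:R * Complex (p j k) 0)
    (q j + (- 1) * Complex (p j 0%N) 0).
  apply: ccvg_near (ccvgD (hq j) (ccvgM (ccvg_cst (-1)) (zero_cvg j))).
  near=> M; rewrite mulN1r -sumrB; apply: eq_bigr => k _.
  by rewrite lt0n; case: eqP => _ /=; rewrite ?mul1r ?mul0r ?subrr ?subr0.
(* The limits for the three kinds of factors; [q j] is the total mass of the law [p j], so an
   occupied cell contributes the mass away from 0. *)
pose L (V : {set 'I_m}) j := if j \in V then q j + (- 1) * Complex (p j 0%N) 0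
   else if j \in D V then l j else Complex (p j 0%N) 0.
have main (phi : 'I_m -> nat -> R[i]) :
    (forall j, ccvg (fun M => \sum_(k < M) phi j k * Complex (p j k) 0) (l j)) ->
    ccvg (fun M => \sum_(n : {ffun 'I_m -> 'I_M})
      deep_prod phi (fun i => n i) * Complex (\prod_i p i (n i)) 0)
    (\sum_(V : {set 'I_m} | V :&: D V == finset.set0) \prod_j L V j).
  move=> hphi.
  have E M : \sum_(n : {ffun 'I_m -> 'I_M})
      deep_prod phi (fun i => n i) * Complex (\prod_i p i (n i)) 0 =
      \sum_(V : {set 'I_m} | V :&: D V == finset.set0) \prod_j \sum_(k < M)
        residue_factor phi V j k * Complex (p j k) 0.
    under eq_bigr do rewrite deep_prod_residue mulr_suml.
    rewrite exchange_big/=; apply: eq_bigr => V _.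
    (* Independence enters here: a sum of products over the box is a product of sums over the
       cells. *)
    rewrite bigA_distr_bigA/=; apply: eq_bigr => n _.
    rewrite big_split/=; congr (_ * _).
    by rewrite -[LHS]/(real_complex R _) rmorph_prod.
  under eq_fun do rewrite E.
  apply: ccvg_sum => V _; apply: ccvg_prod => j _.
  by rewrite /residue_factor /L; case: ifP => // _; case: ifP.
have [_ c1] := cexpect_discrete iY1 b1.
have [_ c2] := cexpect_discrete iY2 b2.
by rewrite (ccvg_unique c1 (main _ h1)) (ccvg_unique c2 (main _ h2)).
Unshelve. all: by end_near. Qed.

End DiscreteVariables.

(** * The generating function of the Poisson law *)

Section PoissonVariables.
Variable R : realType.

Lemma cexpD (z w : R[i]) : cexp (z + w) = cexp z * cexp w.
Proof.
case: z => a b; case: w => c d; apply: complex_eq; rewrite ?cReM ?cImM/=.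
  by rewrite expRD cosD; ring.
by rewrite expRD sinD; ring.
Qed.

Lemma cexp0 : cexp (0 : R[i]) = 1.
Proof. by apply: complex_eq; rewrite /cexp/= expR0 ?cos0 ?sin0 ?mulr1 ?mulr0. Qed.

Lemma cexp_sum (I : Type) (r : seq I) (Q : pred I) (f : I -> R[i]) :
  cexp (\sum_(i <- r | Q i) f i) = \prod_(i <- r | Q i) cexp (f i).
Proof. by elim/big_rec2: _ => [|i a b _ <-]; rewrite ?cexp0// cexpD. Qed.

Lemma cabs_cexp (z : R[i]) : cabs (cexp z) = expR (cRe z).
Proof.
rewrite /cabs /cexp/= !exprMn -mulrDr cos2Dsin2 mulr1 sqrtr_sqr.
by rewrite ger0_norm// expR_ge0.
Qed.

Lemma cexp_ccvg (x : nat -> R) (l : R) (z : R[i]) : x n @[n --> \oo] --> l ->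
  ccvg (fun n => cexp (z * Complex (x n) 0)) (cexp (z * Complex l 0)).
Proof.
case: z => a b xl; rewrite /cexp.
have c1 : a * x n - b * 0 @[n --> \oo] --> a * l - b * 0.
  by apply: cvgB; [apply: cvgMr|exact: cvg_cst].
have c2 : a * 0 + b * x n @[n --> \oo] --> a * 0 + b * l.
  by apply: cvgD; [exact: cvg_cst|apply: cvgMr].
have e1 := continuous_cvg _ (@continuous_expR R _) c1.
have e2 := continuous_cvg _ (@continuous_cos R _) c2.
have e3 := continuous_cvg _ (@continuous_sin R _) c2.
by split; [exact: (cvgM (e1 _) (e2 _))|exact: (cvgM (e1 _) (e3 _))].
Qed.

Lemma poisson_sum (lam : R) (w : R[i]) M :
  \sum_(k < M) w ^+ k * Complex (poisson_p lam k) 0 =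
  Complex (expR (- lam)) 0 * exp_sum (Complex lam 0 * w) M.
Proof.
rewrite /exp_sum mulr_sumr; apply: eq_bigr => k _.
have -> : Complex (poisson_p lam k) 0 =
    Complex (expR (- lam)) 0 * Complex lam 0 ^+ k / (k`!)%:R.
  rewrite /poisson_p -![Complex _ 0]/(real_complex R _).
  by rewrite !rmorphM/= fmorphV rmorphXn/= rmorph_nat.
by rewrite exprMn; ring.
Qed.

(** The factor [expR (- lam)] cancels the summand 1 in [lam * (1 + z)]; this is why the generating
    function is evaluated at [z + 1]. *)
Lemma poisson_sum_ccvg (lam : R) (z : R[i]) :
  ccvg (fun M => \sum_(k < M) (1 + z) ^+ k * Complex (poisson_p lam k) 0)
    (cexp (z * Complex lam 0)).
Proof.
have -> : cexp (z * Complex lam 0) =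
    Complex (expR (- lam)) 0 * cexp (Complex lam 0 * (1 + z)).
  rewrite mulrDr mulr1 cexpD mulrA (mulrC z).
  suff -> : Complex (expR (- lam)) 0 * cexp (Complex lam 0) = 1 by rewrite mul1r.
  apply: complex_eq; rewrite /cexp ?cReM ?cImM/= ?cos0 ?sin0 !mulr0 ?mul0r ?addr0//.
  by rewrite mulr1 subr0 -expRD addNr expR0.
under eq_fun do rewrite poisson_sum.
by apply: ccvgM; [exact: ccvg_cst|exact: exp_sum_ccvg].
Qed.

Lemma poisson_mass_ccvg (lam : R) :
  ccvg (fun M => \sum_(k < M) Complex (poisson_p lam k) 0) 1.
Proof.
have := poisson_sum_ccvg lam 0; rewrite mul0r cexp0 addr0.
by under eq_fun do under eq_bigr do rewrite expr1n mul1r.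
Qed.

Lemma exp_sum_le (x : R) M : 0 <= x -> exp_sum x M <= expR x.
Proof.
move=> x0; have h := @exp_sum_cvgR R x.
rewrite -(cvg_lim (@Rhausdorff R) h); apply: nondecreasing_cvgn_le; last first.
  by apply/cvg_ex; exists (expR x).
apply/nondecreasing_seqP => n; rewrite /exp_sum big_ord_recr/= lerDl.
by rewrite divr_ge0// exprn_ge0.
Qed.

End PoissonVariables.

Section NatVariables.
Context {R : realType} {dO : measure_display} {Omega : measurableType dO}.
Variable P : probability Omega R.
Variable N : Omega -> nat.
Hypothesis mN : forall n, measurable [set w | N w = n].

Lemma measurable_fun_nat (f : nat -> R) :
  measurable_fun [set: Omega] (fun w => f (N w)).
Proof.
move=> _ Y mY; rewrite setTI.
have -> : (fun w => f (N w)) @^-1` Y = \bigcup_(n in [set n | Y (f n)]) [set w | N w = n].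
  apply/seteqP; split => [w /= Yw|w [n /= Yn E]]; last by rewrite /= E.
  by exists (N w).
by apply: bigcup_measurable => n _; exact: mN.
Qed.

Lemma cmeasurable_nat (F : nat -> R[i]) : cmeasurable (fun w => F (N w)).
Proof.
split; [exact: (measurable_fun_nat (fun n => cRe (F n)))|].
exact: (measurable_fun_nat (fun n => cIm (F n))).
Qed.

(** Monotone convergence along the truncations [f M], whose integrals stay below
    [expR (- lam) * expR (lam * c)]. With an arbitrary base [c], these powers dominate all
    integrands built from counts. *)
Lemma integrable_poisson_exp (lam c : R) : 0 <= lam -> 0 <= c ->
  (forall n, P [set w | N w = n] = (poisson_p lam n)%:E) ->
  P.-integrable [set: Omega] (EFin \o (fun w => c ^+ N w)).
Proof.
move=> lam0 c0 pN.
pose f M w : R := \sum_(i < M) c ^+ i * \1_([set w | N w = i]) w.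
have mNi (i : nat) : measurable [set w | N w = i] by exact: mN.
have fint M : P.-integrable [set: Omega] (EFin \o f M) /\
    Rintegral P [set: Omega] (f M) = \sum_(i < M) c ^+ i * fine (P [set w | N w = i]).
  exact: (Rintegral_simple P (index_enum 'I_M) (fun i => c ^+ i) (fun i : 'I_M => mN i)).
have term0 i w : 0 <= c ^+ i * \1_([set w | N w = i]) w :> R.
  by rewrite mulr_ge0// exprn_ge0.
have f0 M w : 0 <= f M w by apply: sumr_ge0.
have ndf w : nondecreasing_seq (fun M => (f M w)%:E).
  apply/nondecreasing_seqP => M; rewrite lee_fin /f [leRHS]big_ord_recr/=.
  by rewrite lerDl.
have flim w : f M w @[M --> \oo] --> c ^+ N w.
  apply: cvg_near_cst; near=> M.
  have NM : (N w < M)%N by near: M; exact: nbhs_infty_gt.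
  rewrite /f (bigD1 (Ordinal NM))//= indicE mem_set// mulr1 big1 ?addr0// => i iN.
  rewrite indicE memNset ?mulr0// => /= E; move/eqP: iN; apply.
  by apply/val_inj; rewrite /= E.
apply/integrableP; split.
  by apply/measurable_EFinP; exact: (measurable_fun_nat (fun n => c ^+ n)).
rewrite [X in (X < _)%E](_ : _ = (\int[P]_w limn (fun M => (f M w)%:E))%E); last first.
  apply: eq_integral => w _; rewrite /= ger0_norm ?exprn_ge0//.
  by apply/esym/cvg_lim => //; apply: cvg_EFin; [near=> M|exact: flim].
rewrite monotone_convergence//; last 2 first.
- by move=> M; exact: measurable_int (fint M).1.
- by move=> M w _; rewrite lee_fin.
apply: (@le_lt_trans _ _ ((expR (- lam) * expR (lam * c))%:E)); last exact: ltry.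
apply: lime_le.
  apply: ereal_nondecreasing_is_cvgn => M1 M2 M12.
  apply: ge0_le_integral => //.
  - by move=> w _; rewrite lee_fin.
  - exact: measurable_int (fint M1).1.
  - exact: measurable_int (fint M2).1.
  - by move=> w _; exact: ndf.
near=> M; rewrite -[leLHS]fineK; last exact: integrable_fin_num (fint M).1.
rewrite lee_fin -/(Rintegral P setT (f M)) (fint M).2.
have -> : \sum_(i < M) c ^+ i * fine (P [set w | N w = i]) =
    expR (- lam) * exp_sum (lam * c) M.
  rewrite /exp_sum mulr_sumr; apply: eq_bigr => i _; rewrite pN /= /poisson_p exprMn.
  by ring.
by rewrite ler_wpM2l ?expR_ge0// exp_sum_le// mulr_ge0.
Unshelve. all: by end_near. Qed.

End NatVariables.

(** * Differentiation under the expectation *)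

Section ComplexExpectationBounds.
Context {R : realType} {dO : measure_display} {Omega : measurableType dO}.
Variable P : probability Omega R.
Implicit Types (X : Omega -> R[i]) (Y : Omega -> R).

Lemma cintegrable_dom X Y : cmeasurable X -> (forall w, cabs (X w) <= Y w) ->
  P.-integrable [set: Omega] (EFin \o Y) -> cintegrable P X.
Proof.
move=> [m1 m2] XY iY; split.
  apply: le_integrable iY => //; first exact/measurable_EFinP.
  move=> w _; rewrite /= lee_fin (le_trans (normRe_cabs _))//.
  by rewrite (le_trans (XY w))// ler_norm.
apply: le_integrable iY => //; first exact/measurable_EFinP.
move=> w _; rewrite /= lee_fin (le_trans (normIm_cabs _))//.
by rewrite (le_trans (XY w))// ler_norm.
Qed.

Lemma cexpectB_scale X1 X2 X3 (a : R[i]) :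
  cintegrable P X1 -> cintegrable P X2 -> cintegrable P X3 ->
  cexpect P (fun w => X1 w - X2 w - a * X3 w) =
  cexpect P X1 - cexpect P X2 - a * cexpect P X3.
Proof.
move=> [a1 b1] [a2 b2] [a3 b3].
have iZ (r : R) (f : Omega -> R) : P.-integrable [set: Omega] (fun w => (f w)%:E) ->
    P.-integrable [set: Omega] (EFin \o (fun w => r * f w)).
  move=> fi; have := integrableZl measurableT r fi.
  by apply: eq_integrable.
have iD (f g : Omega -> R) : P.-integrable [set: Omega] (EFin \o f) ->
    P.-integrable [set: Omega] (EFin \o g) ->
    P.-integrable [set: Omega] (EFin \o (fun w => f w + g w)).
  by move=> fi gi; have := integrableD measurableT fi gi; apply: eq_integrable.
have iB (f g : Omega -> R) : P.-integrable [set: Omega] (EFin \o f) ->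
    P.-integrable [set: Omega] (EFin \o g) ->
    P.-integrable [set: Omega] (EFin \o (fun w => f w - g w)).
  by move=> fi gi; have := integrableB measurableT fi gi; apply: eq_integrable.
apply: complex_eq; rewrite !(cReD, cImD, cReN, cImN, cReM, cImM)/=.
  under eq_Rintegral do rewrite !(cReD, cReN, cReM).
  rewrite RintegralB//; [|exact: iB|by apply: iB; exact: iZ].
  rewrite RintegralB// RintegralB//; [|exact: iZ|exact: iZ].
  by rewrite !RintegralZl.
under eq_Rintegral do rewrite !(cImD, cImN, cImM).
rewrite RintegralB//; [|exact: iB|by apply: iD; exact: iZ].
rewrite RintegralB// RintegralD//; [|exact: iZ|exact: iZ].
by rewrite !RintegralZl.
Qed.

(** The factor 2 comes from bounding real and imaginary parts separately; a bound up to a constant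
    is enough for the derivative. *)
Lemma cabs_cexpect_le X Y : cmeasurable X -> (forall w, cabs (X w) <= Y w) ->
  P.-integrable [set: Omega] (EFin \o Y) ->
  cabs (cexpect P X) <= 2 * Rintegral P [set: Omega] Y.
Proof.
move=> mX XY iY; have [i1 i2] := cintegrable_dom mX XY iY.
rewrite (le_trans (cabs_ReIm _))//= mulr_natl mulr2n lerD//.
  rewrite (le_trans (le_normr_Rintegral _ i1))// le_Rintegral//.
    exact: (integrable_norm i1).
  by move=> w _; rewrite (le_trans (normRe_cabs _)).
rewrite (le_trans (le_normr_Rintegral _ i2))// le_Rintegral//.
  exact: (integrable_norm i2).
by move=> w _; rewrite (le_trans (normIm_cabs _)).
Qed.

End ComplexExpectationBounds.

Section GeneratingFunction.
Context {R : realType} {dO : measure_display} {Omega : measurableType dO}.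
Variable P : probability Omega R.

(** By induction: the remainder for [n.+1] is [z] times the remainder for [n], plus [(z - z0) ^+ 2]
    times the derivative of the [n]-th power at [z0]. The base [4 * c] closes the induction, as
    [c + 1 <= 4 * c], and keeps the bound exponential in [n], hence integrable for a Poisson
    count. *)
Lemma power_taylor_bound (z z0 : R[i]) (c : R) n : 1 <= c -> cabs z <= c -> cabs z0 <= c ->
  cabs (z ^+ n - z0 ^+ n - (z - z0) * (n%:R * z0 ^+ n.-1)) <=
  cabs (z - z0) ^+ 2 * (4 * c) ^+ n.
Proof.
move=> c1 zc z0c; elim: n => [|n ih].
  by rewrite !expr0 subrr mul0r mulr0 subrr cabs0 mulr_ge0// sqr_ge0.
have E : z ^+ n.+1 - z0 ^+ n.+1 - (z - z0) * (n.+1%:R * z0 ^+ n) =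
    z * (z ^+ n - z0 ^+ n - (z - z0) * (n%:R * z0 ^+ n.-1)) +
    (z - z0) ^+ 2 * (n%:R * z0 ^+ n.-1).
  case: n {ih} => [|n]; first by rewrite !expr0 expr1; ring.
  by rewrite -[n.+2%:R]natr1 !exprS /=; ring.
rewrite E (le_trans (cabsD _ _))//.
have c0 : 0 <= c by exact: le_trans c1.
have cn : cabs (n%:R : R[i]) = n%:R.
  have -> : (n%:R : R[i]) = Complex n%:R 0 by rewrite -[RHS]/(real_complex R _) rmorph_nat.
  by rewrite cabs_real ger0_norm.
have -> : cabs ((z - z0) ^+ 2 * (n%:R * z0 ^+ n.-1)) =
    cabs (z - z0) ^+ 2 * (n%:R * cabs z0 ^+ n.-1).
  by rewrite cabsM cabsX cabsM cn cabsX.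
rewrite cabsM.
have b1 : cabs z * cabs (z ^+ n - z0 ^+ n - (z - z0) * (n%:R * z0 ^+ n.-1)) <=
    c * (cabs (z - z0) ^+ 2 * (4 * c) ^+ n).
  by apply: ler_pM; rewrite ?cabs_ge0.
have b2 : n%:R * cabs z0 ^+ n.-1 <= (4 * c) ^+ n.
  apply: (@le_trans _ _ (2 ^+ n * c ^+ n)); last first.
    rewrite -exprMn lerXn2r ?nnegrE ?mulr_ge0//.
    by rewrite ler_wpM2r// ler_nat.
  apply: ler_pM => //; first by rewrite exprn_ge0// cabs_ge0.
    by rewrite -natrX ler_nat; apply: ltnW; exact: ltn_expl.
  apply: (@le_trans _ _ (c ^+ n.-1)).
    by rewrite lerXn2r// nnegrE cabs_ge0.
  by rewrite ler_weXn2l// leq_pred.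
apply: (le_trans (lerD b1 (ler_wpM2l (sqr_ge0 _) b2))).
rewrite mulrCA -mulrDr ler_wpM2l ?sqr_ge0// exprS.
have q0 : 0 <= (4 * c) ^+ n by rewrite exprn_ge0// mulr_ge0.
rewrite -[X in _ + X]mul1r -mulrDl ler_wpM2r//; lra.
Qed.

Lemma entire_generating_function (I N : Omega -> nat) (lam : R) :
  (forall n, measurable [set w | I w = n]) ->
  (forall n, measurable [set w | N w = n]) -> 0 <= lam ->
  (forall n, P [set w | N w = n] = (poisson_p lam n)%:E) ->
  (forall w, (I w <= N w)%N) ->
  entire (fun z : R[i] => cexpect P (fun w => z ^+ I w)).
Proof.
move=> mI mN lam0 pN IN z0.
(* Bounds [cabs z] throughout the unit disc around [z0], to which [delta] is restricted. *)
pose c := cabs z0 + 1.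
have c1 : 1 <= c by rewrite lerDr cabs_ge0.
have z0c : cabs z0 <= c by rewrite lerDl.
have c0 : 0 <= c by exact: le_trans c1.
pose Y w := (4 * c) ^+ N w.
have c41 : 1 <= 4 * c by lra.
have iY : P.-integrable [set: Omega] (EFin \o Y).
  by apply: (integrable_poisson_exp mN lam0 _ pN); rewrite mulr_ge0.
have powI w : (4 * c) ^+ I w <= Y w by rewrite ler_weXn2l.
have ipow z : cabs z <= c -> cintegrable P (fun w => z ^+ I w).
  move=> zc; apply: (cintegrable_dom (cmeasurable_nat mI (fun n => z ^+ n)) _ iY) => w.
  rewrite (le_trans _ (powI w))// cabsX lerXn2r ?nnegrE ?cabs_ge0//; first exact: mulr_ge0.
  by rewrite (le_trans zc)//; lra.
pose dX w : R[i] := (I w)%:R * z0 ^+ (I w).-1.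
have idX : cintegrable P dX.
  apply: (cintegrable_dom (cmeasurable_nat mI (fun n => n%:R * z0 ^+ n.-1)) _ iY) => w.
  rewrite (le_trans _ (powI w))// cabsM cabsX.
  have -> : cabs ((I w)%:R : R[i]) = (I w)%:R.
    have -> : ((I w)%:R : R[i]) = Complex (I w)%:R 0.
      by rewrite -[RHS]/(real_complex R _) rmorph_nat.
    by rewrite cabs_real ger0_norm.
  apply: (@le_trans _ _ (2 ^+ I w * c ^+ I w)); last first.
    rewrite -exprMn lerXn2r ?nnegrE ?mulr_ge0//.
    by rewrite ler_wpM2r// ler_nat.
  apply: ler_pM => //; first by rewrite exprn_ge0// cabs_ge0.
    by rewrite -natrX ler_nat; apply: ltnW; exact: ltn_expl.
  apply: (@le_trans _ _ (c ^+ (I w).-1)).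
    by rewrite lerXn2r// nnegrE cabs_ge0.
  by rewrite ler_weXn2l// leq_pred.
exists (cexpect P dX) => e e0.
set K := Rintegral P [set: Omega] Y.
have K0 : 0 <= K by apply: Rintegral_ge0 => w _; rewrite exprn_ge0// mulr_ge0.
(* The quotient differs from the derivative by at most [2 * K * cabs dz]; the added 1 keeps the
   denominator positive. *)
exists (Num.min 1 (e / (2 * K + 1))).
  by rewrite lt_min ltr01 divr_gt0// ltr_wpDl// mulr_ge0.
move=> z /andP[dz0]; rewrite lt_min => /andP[dz1 dze].
have zc : cabs z <= c.
  rewrite -(subrK z0 z) (le_trans (cabsD _ _))// /c addrC lerD2l; exact: ltW.
set dz := z - z0 in dz0 dz1 dze *.
have dzN0 : dz != 0 by rewrite -cabs_eq0 gt_eqF.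
have -> : (cexpect P (fun w => z ^+ I w) - cexpect P (fun w => z0 ^+ I w)) / dz
    - cexpect P dX =
    cexpect P (fun w => z ^+ I w - z0 ^+ I w - dz * dX w) / dz.
  by rewrite cexpectB_scale//; [field|exact: ipow|exact: ipow].
rewrite cabsM cabsV ltr_pdivrMr//.
have iY2 : P.-integrable [set: Omega] (EFin \o (fun w => cabs dz ^+ 2 * Y w)).
  by have := integrableZl measurableT (cabs dz ^+ 2) iY; apply: eq_integrable.
apply: (@le_lt_trans _ _ (2 * (cabs dz ^+ 2 * K))).
  rewrite -RintegralZl//; apply: cabs_cexpect_le => //.
    exact: (cmeasurable_nat mI (fun n => z ^+ n - z0 ^+ n - dz * (n%:R * z0 ^+ n.-1))).
  move=> w; apply: (le_trans (power_taylor_bound _ c1 zc z0c)).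
  by rewrite ler_wpM2l// sqr_ge0.
rewrite mulrCA expr2 -mulrA [X in _ < X]mulrC ltr_pM2l//.
have : cabs dz * (2 * K + 1) < e by rewrite -ltr_pdivlMr// ltr_wpDl// mulr_ge0.
by rewrite mulrDr mulr1; lra.
Qed.

End GeneratingFunction.

(** * Discretization of the Poisson process *)

Section BorelSets.
Variables (R : realType) (d : nat).

Lemma measurable_closed (A : set 'rV[R]_d) :
  closed A -> measurable (A : set (borel_rV R d)).
Proof.
move=> cA; rewrite -(setCK A); apply: measurableC; apply: sub_sigma_algebra.
exact: closed_openC.
Qed.

Lemma measurable_open (A : set 'rV[R]_d) :
  open A -> measurable (A : set (borel_rV R d)).
Proof. by move=> oA; apply: sub_sigma_algebra. Qed.

Lemma closed_cube (c : 'rV[R]_d) r : closed (cube c r).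
Proof.
rewrite -openC openE => x /= /existsNP[i /negP]; rewrite -ltNge => xi.
apply/interiorP; exists ((`|x ord0 i - c ord0 i| - r) / 2).
  by rewrite divr_gt0// subr_gt0.
move=> y xy yc; have := yc i; have := xy i.
have := ler_normD (x ord0 i - y ord0 i) (y ord0 i - c ord0 i).
rewrite addrA subrK (distrC (x ord0 i) (y ord0 i)); lra.
Qed.

Lemma measurable_conv_hull (s : seq 'rV[R]_d) :
  measurable (conv_hull s : set (borel_rV R d)).
Proof.
apply: measurable_closed; apply: compact_closed; last exact: conv_hull_compact.
exact: norm_hausdorff.
Qed.

End BorelSets.

Lemma conv_hull_interior_measure (R : realType) (d : nat)
    (mu : probability (borel_rV R d.+1) R) (mu_ac : abs_cont_lebesgue mu)
    (s : seq 'rV[R]_d.+1) :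
  mu (interior (conv_hull s)) = mu (conv_hull s).
Proof.
pose K : set (borel_rV R d.+1) := conv_hull s.
pose I : set (borel_rV R d.+1) := interior (conv_hull s).
rewrite -/K -/I.
have mI : measurable I by apply: measurable_open; exact: open_interior.
have mK : measurable K by exact: measurable_conv_hull.
have mD := measurableD mK mI.
have h0 : mu (K `\` I) = 0%E := mu_ac _ mD (@conv_hull_boundary_null R d s).
have IK : I `<=` K by exact: interior_subset.
have I0 : I `&` (K `\` I) = set0 by apply/seteqP; split => x // -[h1 [_]].
have h : mu (I `|` (K `\` I)) = (mu I + mu (K `\` I))%E := measureU mu mI mD I0.
by rewrite -(setDUK IK) h h0 adde0.
Qed.

(** * Counting points in sets *)

Section PointCounts.
Variable T : Type.
Implicit Types (s : seq T) (A B : set T).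

Lemma bigsetUP (I : eqType) (r : seq I) (Q : pred I) (F : I -> set T) x :
  (\big[setU/set0]_(i <- r | Q i) F i) x <-> exists i, [/\ i \in r, Q i & F i x].
Proof.
elim: r => [|i r ih]; first by rewrite big_nil; split => // -[i []].
rewrite big_cons; case: ifPn => Qi; split.
- case=> [Fx|/ih[k [kr Qk Fk]]]; first by exists i; rewrite mem_head.
  by exists k; rewrite inE kr orbT.
- move=> [k [+ Qk Fk]]; rewrite inE => /orP[/eqP <-|kr]; first by left.
  by right; apply/ih; exists k.
- by move=> /ih[k [kr Qk Fk]]; exists k; rewrite inE kr orbT.
- move=> [k [+ Qk Fk]]; rewrite inE => /orP[/eqP kE|kr].
    by rewrite -kE Qk in Qi.
  by apply/ih; exists k.
Qed.

Lemma npoints_bigsetU s m (G : {set 'I_m}) (A : 'I_m -> set T) :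
  trivIset setT A ->
  npoints s (\big[setU/set0]_(j < m | j \in G) A j) = (\sum_(j in G) npoints s (A j))%N.
Proof.
move=> tA; elim: s => [|x s ih]; first by rewrite [RHS]big1.
have E B : npoints (x :: s) B = (`[< B x >] + npoints s B)%N by [].
rewrite E ih; under [RHS]eq_bigr do rewrite E.
rewrite big_split/=; congr (_ + _)%N.
have [/bigsetUP[j [_ jG Ax]]|nU] := pselect ((\big[setU/set0]_(j < m | j \in G) A j) x).
  rewrite asboolT; last by apply/bigsetUP; exists j; rewrite mem_index_enum.
  rewrite (bigD1 j)//= asboolT// big1 ?addn0// => k /andP[_ kj].
  rewrite asboolF// => Ak; move/eqP: kj; apply; apply: tA => //.
  by exists x.
rewrite asboolF// big1// => j jG; rewrite asboolF// => Ax; apply: nU.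
by apply/bigsetUP; exists j; rewrite mem_index_enum.
Qed.

Lemma npoints_setT s : npoints s setT = size s.
Proof. by rewrite /npoints (eq_count (a2 := predT)) ?count_predT// => x; rewrite asboolT. Qed.

Lemma npoints_le s A : (npoints s A <= npoints s setT)%N.
Proof. by rewrite npoints_setT; exact: count_size. Qed.

End PointCounts.

(** The base [1 + cabs z] is at least 1, so its powers increase and the total count may replace the
    count in [A]. *)
Lemma cabs_pow_npoints (R : realType) (T : Type) (s : seq T) A (z : R[i]) :
  cabs (z ^+ npoints s A) <= (1 + cabs z) ^+ npoints s setT.
Proof.
rewrite cabsX; apply: (@le_trans _ _ ((1 + cabs z) ^+ npoints s A)).
  by rewrite lerXn2r ?nnegrE ?addr_ge0 ?cabs_ge0// lerDr.
by rewrite ler_weXn2l ?npoints_le// lerDl cabs_ge0.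
Qed.

Lemma complex_sum (R : realType) (I : Type) (r : seq I) (Q : pred I) (f : I -> R) :
  Complex (\sum_(i <- r | Q i) f i) 0 = \sum_(i <- r | Q i) Complex (f i) 0 :> R[i].
Proof.
elim/big_rec2: _ => // i x y _ <-.
by apply: complex_eq; rewrite ?cReD ?cImD/= ?addr0.
Qed.

Section Discretization.
Variables (R : realType) (d : nat) (mu : probability (borel_rV R d.+1) R).
Variables (t : R) (dO : measure_display) (Omega : measurableType dO).
Variables (P : probability Omega R) (eta : Omega -> seq 'rV[R]_d.+1).
Hypothesis t_ge0 : 0 <= t.
Hypothesis eta_ppp : is_poisson_pp P eta (fun A => t * fine (mu A)).

Let K w := conv_hull (eta w).

Lemma npoints_measurable (A : set (borel_rV R d.+1)) n : measurable A ->
  measurable [set w | npoints (eta w) A = n].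
Proof. by move=> mA; case: eta_ppp => _ /(_ A mA n)[]. Qed.

Lemma npoints_setT_poisson n :
  P [set w | npoints (eta w) setT = n] = (poisson_p t n)%:E.
Proof.
case: eta_ppp => _ /(_ setT measurableT n)[_ ->] _.
by rewrite probability_setT mulr1.
Qed.

Lemma integrable_exp_npoints (c : R) : 0 <= c ->
  P.-integrable [set: Omega] (EFin \o (fun w => c ^+ npoints (eta w) setT)).
Proof.
move=> c0; apply: integrable_poisson_exp t_ge0 c0 npoints_setT_poisson.
by move=> n; exact: npoints_measurable.
Qed.

Lemma cabs_cexp_le (z : R[i]) (x : R) : 0 <= x <= t ->
  cabs (cexp (z * Complex x 0)) <= expR (cabs z * t).
Proof.
move=> /andP[x0 xt]; rewrite cabs_cexp ler_expR cReM/= mulr0 subr0.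
rewrite (le_trans (ler_norm _))// normrM (ger0_norm x0).
by apply: ler_pM => //; exact: normRe_cabs.
Qed.

(** The cells have radius [1 / n.+1] and cover the cube of radius [n.+1], so fineness and extent
    improve together. Points outside that cube belong to no guaranteed cell, hence the condition on
    [eta w] in the third clause; its constant 5 is that of [interior_sub_deep]. [U w] is the union
    of the deep cells. *)
Lemma discretization (n : nat) : exists U : Omega -> set 'rV[R]_d.+1,
  [/\ forall w, measurable (U w : set (borel_rV R d.+1)),
      forall w, U w `<=` interior (K w),
      forall w x, cube x (5 / n.+1%:R) `<=` K w ->
        (forall y, y \in eta w -> cube 0 n.+1%:R y) -> U w x &
      forall z : R[i],
      let X := fun w => (1 + z) ^+ npoints (eta w) (U w) in
      let W := fun w => cexp (z * Complex (t * fine (mu (U w))) 0) in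
      [/\ cmeasurable X, cmeasurable W & cexpect P X = cexpect P W]].
Proof.
pose rho : R := n.+1%:R; pose e : R := n.+1%:R^-1.
have rho0 : 0 < rho by rewrite ltr0n.
have e0 : 0 < e by rewrite invr_gt0.
have [l hl] := @cube_cover R d.+1 rho e rho0 e0.
pose m := size l; pose c (j : 'I_m) := nth 0 l j.
pose B (k : nat) : set (borel_rV R d.+1) := cube (nth 0 l k) e.
(* The covering cubes overlap; each is deprived of the earlier ones, and a point then falls in the
   cell of the first cube containing it. *)
pose A (j : 'I_m) : set (borel_rV R d.+1) := seqDU B j.
have mB k : measurable (B k) by apply: measurable_closed; exact: closed_cube.
have mA j : measurable (A j).
  by apply: measurableD => //; apply: bigsetU_measurable.
have tA : trivIset setT A.
  by move=> i j _ _ ij; apply/val_inj; apply: (@trivIset_seqDU _ B).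
have dA i j : i != j -> A i `&` A j = set0.
  by move=> ij; have /trivIsetP h := tA; exact: h.
have Ac j : A j `<=` cube (c j) e by move=> x [].
have Acover x : cube 0 rho x -> exists j, A j x.
  move=> /hl[y yl xy].
  have ex : exists k, `[< B k x >].
    by exists (index y l); apply/asboolP; rewrite /B nth_index.
  have [k /asboolP Bk kmin] := ex_minnP ex.
  have km : (k < m)%N.
    rewrite (@leq_ltn_trans (index y l)) ?index_mem//.
    by apply: kmin; apply/asboolP; rewrite /B nth_index.
  exists (Ordinal km); split => //= /bigsetUP[i [_ _ /asboolP Bi]].
  by have := kmin _ Bi; rewrite leqNgt ltn_ord.
pose N (j : 'I_m) w := npoints (eta w) (A j).
pose lam (j : 'I_m) : R := t * fine (mu (A j)).
pose p (j : 'I_m) k := poisson_p (lam j) k.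
have mN j k : measurable [set w | N j w = k] by exact: npoints_measurable.
have pN (k : 'I_m -> nat) : P (\bigcap_(i in [set: 'I_m]) [set w | N i w = k i]) =
    (\prod_i p i (k i))%:E.
  case: eta_ppp => _ h2 h3; rewrite h3// -prodEFin; apply: eq_bigr => i _.
  by have [_ ->] := h2 _ (mA i) (k i).
have r0 : 0 < 3 * e by rewrite mulr_gt0.
pose D := deep c (3 * e).
pose G w : {set 'I_m} := D (support_of (N^~ w)).
pose U w : set (borel_rV R d.+1) := \big[setU/set0]_(j < m | j \in G w) A j.
have muU w : t * fine (mu (U w)) = \sum_(j in G w) lam j.
  rewrite /U measure_bigsetU_ord// -mulr_sumr; congr (_ * _).
  by rewrite sum_fine// => j _; exact: fin_num_measure.
have muU_bound w : 0 <= t * fine (mu (U w)) <= t.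
  have mU : measurable (U w) by apply: bigsetU_measurable.
  rewrite mulr_ge0 ?fine_ge0//= -[leRHS]mulr1 ler_wpM2l//.
  by rewrite -lee_fin fineK ?fin_num_measure//; exact: probability_le1.
exists U; split.
- by move=> w; apply: bigsetU_measurable.
- move=> w x /bigsetUP[j [_ jG Ax]].
  exact: (deep_sub_interior e0 Ac jG Ax).
- move=> w x xK wrho.
  have xrho : cube 0 rho x.
    by apply: (conv_hull_cube wrho); apply: xK; apply: cube_center; rewrite divr_ge0.
  have [j Ax] := Acover _ xrho.
  apply/bigsetUP; exists j; split; [exact: mem_index_enum| |exact: Ax].
  apply: (interior_sub_deep e0 Ac _ _ xK Ax) => //.
  by move=> y /wrho /Acover.
move=> z X W.
have XE w : X w = deep_prod D (fun _ k => (1 + z) ^+ k) (N^~ w).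
  rewrite /X /U npoints_bigsetU// /deep_prod -/(G w).
  by rewrite (big_morph _ (exprD (1 + z)) (expr0 _)).
have WE w : W w = deep_prod D (fun j _ => cexp (z * Complex (lam j) 0)) (N^~ w).
  by rewrite /W muU complex_sum mulr_sumr cexp_sum.
have iY1 : P.-integrable [set: Omega]
    (EFin \o (fun w => (1 + cabs (1 + z)) ^+ npoints (eta w) setT)).
  by apply: integrable_exp_npoints; rewrite addr_ge0// cabs_ge0.
have iY2 : P.-integrable [set: Omega] (EFin \o (fun=> expR (cabs z * t))).
  exact: finite_measure_integrable_cst.
have b1 w : cabs (deep_prod D (fun _ k => (1 + z) ^+ k) (N^~ w)) <=
    (1 + cabs (1 + z)) ^+ npoints (eta w) setT.
  by rewrite -XE; exact: cabs_pow_npoints.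
have b2 w : cabs (deep_prod D (fun j _ => cexp (z * Complex (lam j) 0)) (N^~ w)) <=
    expR (cabs z * t).
  by rewrite -WE; exact: cabs_cexp_le.
have -> : X = fun w => deep_prod D (fun _ k => (1 + z) ^+ k) (N^~ w).
  by apply/funext => w; exact: XE.
have -> : W = fun w => deep_prod D (fun j _ => cexp (z * Complex (lam j) 0)) (N^~ w).
  by apply/funext => w; exact: WE.
(* Integrability is invoked here for the measurability of [X] and [W] that it contains. *)
have [[m1 m2] _] := @cexpect_discrete _ _ _ P m N p mN pN _ _ iY1 b1.
have [[m3 m4] _] := @cexpect_discrete _ _ _ P m N p mN pN _ _ iY2 b2.
split.
- by split; apply/measurable_EFinP; [exact: measurable_int m1|exact: measurable_int m2].
- by split; apply/measurable_EFinP; [exact: measurable_int m3|exact: measurable_int m4].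
apply: (@cexpect_deep_prod_eq _ _ _ P m N p mN pN D _ _ _ _ _
  (fun j => cexp (z * Complex (lam j) 0)) _ _ _ _ iY1 b1 iY2 b2).
- exact: deep_setD.
- by move=> O V; exact: deep_residueE.
- by move=> j; exists 1; exact: poisson_mass_ccvg.
- by move=> j; exact: poisson_sum_ccvg.
- move=> j; have := ccvgM (ccvg_cst (cexp (z * Complex (lam j) 0))) (poisson_mass_ccvg (lam j)).
  by rewrite mulr1; under eq_fun do rewrite mulr_sumr.
Qed.

End Discretization.

(** The chain rule, by which [h] inherits differentiability from [g] through the functional
    equation. *)
Lemma entire_affine (R : realType) (f : R[i] -> R[i]) (a b : R[i]) :
  a != 0 -> entire f -> entire (fun z => f (a * z + b)).
Proof.
move=> a0 ef z0; have [l hl] := ef (a * z0 + b).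
have ca : 0 < cabs a by rewrite lt_def cabs_eq0 a0 cabs_ge0.
exists (a * l) => e e0.
have [|delta delta0 h] := hl (e / cabs a); first exact: divr_gt0.
exists (delta / cabs a) => [|z /andP[dz0 dz]]; first exact: divr_gt0.
have dzN0 : z - z0 != 0 by rewrite -cabs_eq0 gt_eqF.
have E : a * z + b - (a * z0 + b) = a * (z - z0) by ring.
have := h (a * z + b); rewrite E cabsM mulr_gt0//= [X in X < _]mulrC -ltr_pdivlMr//.
move=> /(_ dz); rewrite ltr_pdivlMr// -cabsM; congr (cabs _ < _).
by field; rewrite a0 dzN0.
Qed.

(** * Convergence of the deep cells to the interior of a fixed polytope *)

Section PolytopeLimits.
Variables (R : realType) (d : nat) (mu : probability (borel_rV R d.+1) R).
Hypothesis mu_ac : abs_cont_lebesgue mu.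
Variables (s : seq 'rV[R]_d.+1) (U : nat -> set 'rV[R]_d.+1).
Hypothesis mU : forall n, measurable (U n : set (borel_rV R d.+1)).
Hypothesis U_sub : forall n, U n `<=` interior (conv_hull s).
Hypothesis U_sup : forall n x, cube x (5 / n.+1%:R) `<=` conv_hull s ->
  (forall y, y \in s -> cube 0 n.+1%:R y) -> U n x.

Lemma near_mem_interior x : \forall n \near \oo, U n x = interior (conv_hull s) x.
Proof.
have [Kx|nKx] := pselect (interior (conv_hull s) x); last first.
  by near=> n; apply/propext; split => // /U_sub.
have [r r0 rK] := (interiorP _ _).1 Kx.
have [rho rho0 srho] := seq_bounded s.
near=> n; apply/propext; split => // _.
apply: U_sup.
  apply: subset_trans rK; apply: cube_le.
  rewrite ler_pdivrMr// mulrC -ler_pdivrMr//.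
  apply: (@le_trans _ _ n%:R); last by rewrite ler_nat.
  by near: n; exact: nbhs_infty_ger.
move=> y /srho; apply: cube_le; apply: (@le_trans _ _ n%:R); last by rewrite ler_nat.
by near: n; exact: nbhs_infty_ger.
Unshelve. all: by end_near. Qed.

Lemma near_npoints_interior :
  \forall n \near \oo, npoints s (U n) = n_interior s.
Proof.
(* The list being counted is separated from the one spanning the hull, which must stay fixed in the
   induction. *)
suff H s' : \forall n \near \oo, npoints s' (U n) = npoints s' (interior (conv_hull s)).
  exact: H.
elim: s' => [|x s' ih]; first by near=> n.
near=> n.
have -> : npoints (x :: s') (U n) = (`[< U n x >] + npoints s' (U n))%N by [].
rewrite (near ih n)//.
by have -> : U n x = interior (conv_hull s) x by near: n; exact: near_mem_interior.
Unshelve. all: by end_near. Qed.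

(** Dominated convergence of indicators, this time under [mu]; the null boundary allows the hull in
    place of its interior. *)
Lemma cvg_measure_interior :
  fine (mu (U n)) @[n --> \oo] --> fine (mu (conv_hull s)).
Proof.
rewrite -conv_hull_interior_measure//.
have mI : measurable (interior (conv_hull s) : set (borel_rV R d.+1)).
  by apply: measurable_open; exact: open_interior.
have indicR (A : set (borel_rV R d.+1)) : measurable A ->
    Rintegral mu [set: borel_rV R d.+1] \1_A = fine (mu A).
  by move=> mA; rewrite /Rintegral integral_indic// setIT.
rewrite -indicR//; under eq_fun do rewrite -indicR//.
have [||||_ h] := @dominated_cvg_Rintegral R _ _ mu
    (fun n => \1_(U n)) \1_(interior (conv_hull s)) (fun=> 1).
- by move=> n; exact: measurable_indic.
- move=> x; apply: cvg_near_cst; near=> n; rewrite !indicE.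
  congr (_%:R); congr nat_of_bool; apply/idP/idP; rewrite !inE.
    by rewrite (near (near_mem_interior x) n).
  by rewrite (near (near_mem_interior x) n).
- by move=> n x; rewrite indicE; case: (_ \in _); rewrite ?normr1 ?normr0.
- exact: finite_measure_integrable_cst.
- exact: h.
Unshelve. all: by end_near. Qed.

End PolytopeLimits.

Theorem theorem1 (R : realType) (d : nat)
    (mu : probability (borel_rV R d) R)
    (mu_ac : abs_cont_lebesgue mu)
    (t : R) (t_gt0 : 0 < t)
    (dO : measure_display) (Omega : measurableType dO)
    (P : probability Omega R) (eta : Omega -> seq 'rV[R]_d)
    (eta_ppp : is_poisson_pp P eta (fun A => t * fine (mu A))) :
  let I := fun w => n_interior (eta w) in
  let muPi := fun w => fine (mu (conv_hull (eta w))) in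
  let g := fun z : R[i] => cexpect P (fun w => z ^+ I w) in
  let h := fun z : R[i] => cexpect P (fun w => cexp (z * Complex (muPi w) 0)) in
  [/\ (forall z : R[i], cintegrable P (fun w => z ^+ I w)),
      (forall z : R[i], cintegrable P (fun w => cexp (z * Complex (muPi w) 0))),
      entire g, entire h &
      forall z : R[i], g (z + 1) = h (Complex t 0 * z)].
Proof.
move=> I muPi g h.
have t_ge0 := ltW t_gt0.
case: d mu mu_ac eta eta_ppp @I @muPi @g @h =>
    [|d] mu mu_ac eta eta_ppp I muPi g h.
  (* Points of R^0 coincide, so a simple process cannot have two of them. *)
  exfalso; case: eta_ppp => eta_uniq /(_ setT measurableT 2%N)[_].
  have -> : [set w | npoints (eta w) setT = 2%N] = set0.
    apply/seteqP; split => // w /=; rewrite npoints_setT.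
    case: (eta w) (eta_uniq w) => [|x [|y [|]]]//=.
    by rewrite inE (_ : x = y) ?eqxx//; apply/rowP => -[].
  rewrite measure0 probability_setT mulr1 => /esym/eqP; rewrite eqe.
  by rewrite gt_eqF// /poisson_p divr_gt0// mulr_gt0 ?expR_gt0// exprn_gt0.
have /choice[U hU] := discretization t_ge0 eta_ppp.
have mU n w : measurable (U n w : set (borel_rV R d.+1)) by have [h1 _ _ _] := hU n.
have Usub n w : U n w `<=` interior (conv_hull (eta w)) by have [_ h1 _ _] := hU n.
have Usup n w : forall x, cube x (5 / n.+1%:R) `<=` conv_hull (eta w) ->
    (forall y, y \in eta w -> cube 0 n.+1%:R y) -> U n w x.
  by have [_ _ h1 _] := hU n; exact: h1.
have Ulim w := near_npoints_interior (Usub^~ w) (Usup^~ w).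
have muUlim w : t * fine (mu (U n w)) @[n --> \oo] --> t * muPi w.
  by apply: cvgMr; apply: (cvg_measure_interior mu_ac (mU^~ w) (Usub^~ w) (Usup^~ w)).
have mu_bound (A : set (borel_rV R d.+1)) : measurable A -> 0 <= t * fine (mu A) <= t.
  move=> mA; rewrite mulr_ge0 ?fine_ge0//= -[leRHS]mulr1 ler_wpM2l//.
  by rewrite -lee_fin fineK ?fin_num_measure//; exact: probability_le1.
have gf (z : R[i]) : cintegrable P (fun w => (1 + z) ^+ I w) /\
    ccvg (fun n => cexpect P (fun w => (1 + z) ^+ npoints (eta w) (U n w))) (g (1 + z)).
  apply: (dominated_cvg_cexpect (X := fun n w => (1 + z) ^+ npoints (eta w) (U n w))
      (Y := fun w => (1 + cabs (1 + z)) ^+ npoints (eta w) setT)).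
  - by move=> n; have [_ _ _ /(_ z)[]] := hU n.
  - move=> w; apply: ccvg_near (ccvg_cst _); near=> n.
    by congr (_ ^+ _); apply/esym; near: n; exact: Ulim.
  - by move=> n w; exact: cabs_pow_npoints.
  - by apply: (integrable_exp_npoints t_ge0 eta_ppp); rewrite addr_ge0// cabs_ge0.
have mgf (z : R[i]) : cintegrable P (fun w => cexp (z * Complex (t * muPi w) 0)) /\
    ccvg (fun n => cexpect P (fun w => cexp (z * Complex (t * fine (mu (U n w))) 0)))
      (cexpect P (fun w => cexp (z * Complex (t * muPi w) 0))).
  apply: (dominated_cvg_cexpect
      (X := fun n w => cexp (z * Complex (t * fine (mu (U n w))) 0))
      (Y := fun=> expR (cabs z * t))).
  - by move=> n; have [_ _ _ /(_ z)[]] := hU n.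
  - by move=> w; exact: cexp_ccvg.
  - by move=> n w; apply: cabs_cexp_le; exact: mu_bound.
  - exact: finite_measure_integrable_cst.
have rescale (z : R[i]) (x : R) : z * Complex (t * x) 0 = Complex t 0 * z * Complex x 0.
  rewrite -![Complex _ 0]/(real_complex R _) rmorphM/=; ring.
have gh (z : R[i]) : g (z + 1) = h (Complex t 0 * z).
  rewrite addrC; have [_ c1] := gf z; have [_ c2] := mgf z.
  rewrite (ccvg_unique c1 (z := g (1 + z)) (w := h (Complex t 0 * z)))//.
  have -> : h (Complex t 0 * z) = cexpect P (fun w => cexp (z * Complex (t * muPi w) 0)).
    by congr (cexpect P _); apply/funext => w; rewrite rescale.
  apply: ccvg_near c2; near=> n.
  by have [_ _ _ /(_ z)[_ _]] := hU n.
have t0 : Complex t 0 != 0 by rewrite -cabs_eq0 cabs_real normr_eq0 gt_eqF.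
have eg : entire g.
  apply: (entire_generating_function (N := fun w => npoints (eta w) setT) _ _ t_ge0).
  (* Measurability of [I] comes from the limit argument: at [z = 1] it makes [2 ^+ I w] measurable,
     and [k] is determined by [2 ^+ k]. *)
  - have [[/measurable_int m2 _] _] := gf 1.
    move=> n; have pow2 k : cRe ((1 + 1 : R[i]) ^+ k) = 2 ^+ k.
      have -> : (1 + 1 : R[i]) = real_complex R 2 by rewrite rmorph_nat.
      by rewrite -rmorphXn.
    have -> : [set w | I w = n] =
        (fun w => cRe ((1 + 1 : R[i]) ^+ I w)) @^-1` [set 2 ^+ n].
      apply/seteqP; split => w /=; first by move=> ->; rewrite pow2.
      by rewrite pow2; apply: ieexprIn => //; rewrite gt_eqF// ltr1n.
    move/measurable_EFinP : m2 => /(_ measurableT _ (measurable_set1 (2 ^+ n))).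
    by rewrite setTI.
  - by move=> n; exact: (npoints_measurable eta_ppp).
  - exact: (npoints_setT_poisson eta_ppp).
  - by move=> w; exact: npoints_le.
(* The identity is solved for [h], which makes it an affine reparametrization of the entire function
   [g]. *)
have hE : h = fun z => g ((Complex t 0)^-1 * z + 1).
  by apply/funext => z; rewrite gh mulVKf.
split => //.
- by move=> z; have [+ _] := gf (z - 1); rewrite addrC subrK.
- move=> z; have [+ _] := mgf ((Complex t 0)^-1 * z).
  by under eq_fun do rewrite rescale mulVKf//.
- by rewrite hE; apply: entire_affine => //; rewrite invr_eq0.
Unshelve. all: by end_near. Qed.
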